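(* Let $L=\partial_\tau-\sum_{k=0}^2\mathbb{A}_k(y,\tau)\partial_y^k$ be a strictly parabolic $d\times d$ system on $\mathbb{R}\times(0,T)$ as in the context, with $\mathbb{A}_1,\mathbb{A}_2$ diagonal and with the off-diagonal entries of $\mathbb{A}_0(y,\tau)$ non-negative. Let $\mathbb{B}(y,\tau)=(b_{ij}(y,\tau))_{i,j}$ be a matrix function such that $\mathbb{A}_0-\mathbb{B}$ is diagonal and $b_{ij}(y,\tau)\ge0$ for all $i,j$, let $L_{\rm diag}:=L+\mathbb{B}$ be the resulting diagonal operator, and let $B_*=(b_{*,ij})_{i,j}$, $b_{*,ij}:=\inf_{y,\tau}b_{ij}(y,\tau)$. Let $E=(e_{ij})$ be the fundamental solution of $L$. Then there exist constants $c,C>0$ such that for all $i,j$, all $y,y_0\in\mathbb{R}$ and all $0\le s<\tau<T$, $$e_{ij}(y,\tau;y_0,s)\ \ge\ C\left(e^{c(\tau-s)B_*}\right)_{ij}\,\frac{e^{-\epsilon_0(y-y_0)^2/(\tau-s)}}{\sqrt{\tau-s}} ,$$ where one can in fact take $c=\delta_0(\epsilon_0^{-1}\pi)^{1/2}$ and $C=\delta_0$, with $\delta_0,\epsilon_0>0$ the constants in the Gaussian lower bound for the fundamental solution of $L_{\rm diag}$ given in the context.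
   Context: Coefficients: $\mathbb{A}_k(y,\tau)=(a^k_{ij}(y,\tau))_{1\le i,j\le d}$, $k=0,1,2$, are bounded real $d\times d$ matrix-valued functions on $\mathbb{R}\times[0,T]$, uniformly continuous in $(y,\tau)$ and uniformly Hölder continuous in $y$ with some exponent $\alpha>0$, with $\mathbb{A}_2$ uniformly strictly positive definite; the entries of $\mathbb{B}$ have the same regularity as those of $\mathbb{A}_0$. Off the diagonal $b_{ij}=a^0_{ij}$, while the diagonal entries of $\mathbb{B}$ may be chosen freely subject to $b_{ii}\ge 0$ (e.g. $b_{ii}=0$). The fundamental solution $E(y,\tau;y_0,s)=(e_{ij}(y,\tau;y_0,s))_{i,j}$ of $L$ is the unique matrix function with $LE=0$ (in the variables $(y,\tau)$) for $0\le s<\tau<T$, $\lim_{\tau\to s^+}E(y,\tau;y_0,s)=\delta(y-y_0)I_{d\times d}$, and satisfying Gaussian estimates $|\partial_y^ke_{ij}|\le C(\tau-s)^{-(k+1)/2}e^{-c|y-y_0|^2/(\tau-s)}$ for $k=0,1,2$ and $|\partial_\tau e_{ij}|\le C(\tau-s)^{-3/2}e^{-c|y-y_0|^2/(\tau-s)}$ for some $c,C>0$. The diagonal operator $L_{\rm diag}$ has fundamental solution $E_{\rm diag}=\mathrm{diag}(e_1,\dots,e_d)$, and it is known (Aronson) that there exist constants $\delta_0,\epsilon_0>0$ such that $e_i(y,\tau;y_0,s)\ge\delta_0(\tau-s)^{-1/2}\exp\left(-\epsilon_0(y-y_0)^2/(\tau-s)\right)$ for all $i$, $y,y_0\in\mathbb{R}$,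 $0\le s<\tau<T$. *)

(* Defs.v *)
From HB Require Import structures.
From mathcomp Require Import all_boot all_order all_algebra.
From mathcomp Require Import all_classical all_reals all_analysis.
Set Implicit Arguments.
Unset Strict Implicit.
Unset Printing Implicit Defensive.
Import Order.TTheory GRing.Theory Num.Theory.
Import numFieldNormedType.Exports.
Local Open Scope classical_set_scope.
Local Open Scope ring_scope.

(* Only the values of a coefficient matrix on the strip R x [0, T] matter. *)
Definition coeff_bounded (R : realType) (d : nat) (T : R)
    (A : R -> R -> 'M[R]_d) : Prop :=
  exists M : R, forall (i j : 'I_d) (y tau : R),
    0 <= tau <= T -> `|A y tau i j| <= M.

Definition coeff_unif_continuous (R : realType) (d : nat) (T : R)
    (A : R -> R -> 'M[R]_d) : Prop :=
  forall eps : R, 0 < eps -> exists2 eta : R, 0 < eta &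
    forall (i j : 'I_d) (y y' tau tau' : R),
      0 <= tau <= T -> 0 <= tau' <= T ->
      `|y - y'| < eta -> `|tau - tau'| < eta ->
      `|A y tau i j - A y' tau' i j| < eps.

Definition coeff_holder (R : realType) (d : nat) (T alpha : R)
    (A : R -> R -> 'M[R]_d) : Prop :=
  exists K : R, forall (i j : 'I_d) (y y' tau : R),
    0 <= tau <= T -> `|A y tau i j - A y' tau i j| <= K * `|y - y'| `^ alpha.

Definition coeff_regular (R : realType) (d : nat) (T alpha : R)
    (A : R -> R -> 'M[R]_d) : Prop :=
  [/\ coeff_bounded T A, coeff_unif_continuous T A & coeff_holder T alpha A].

Definition unif_positive_definite (R : realType) (d : nat) (T : R)
    (A : R -> R -> 'M[R]_d) : Prop :=
  exists2 lambda : R, 0 < lambda &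
    forall (y tau : R) (v : 'cV[R]_d), 0 <= tau <= T ->
      lambda * (\sum_i v i 0 ^+ 2) <= (v^T *m A y tau *m v) 0 0.

Definition dy (R : realType) (d : nat) (k : nat) (U : R -> R -> 'M[R]_d)
    (y tau : R) : 'M[R]_d :=
  \matrix_(i, j) derive1n k (fun z : R => U z tau i j) y.

Definition dtau (R : realType) (d : nat) (U : R -> R -> 'M[R]_d)
    (y tau : R) : 'M[R]_d :=
  \matrix_(i, j) derive1 (fun t : R => U y t i j) tau.

Definition parabolic_op (R : realType) (d : nat)
    (A0 A1 A2 U : R -> R -> 'M[R]_d) (y tau : R) : 'M[R]_d :=
  dtau U y tau
  - (A0 y tau *m dy 0 U y tau + A1 y tau *m dy 1 U y tau
     + A2 y tau *m dy 2 U y tau).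

Definition add_zero_order (R : realType) (d : nat)
    (L : (R -> R -> 'M[R]_d) -> R -> R -> 'M[R]_d) (B : R -> R -> 'M[R]_d)
    (U : R -> R -> 'M[R]_d) (y tau : R) : 'M[R]_d :=
  L U y tau + B y tau *m U y tau.

(* Classical solution of L U = 0 on the strip s < tau < T; existence of the
   derivatives is explicit because [derive1n] and [derive1] are total. *)
Definition classical_solution (R : realType) (d : nat) (s T : R)
    (L : (R -> R -> 'M[R]_d) -> R -> R -> 'M[R]_d)
    (U : R -> R -> 'M[R]_d) : Prop :=
  forall y tau : R, s < tau < T ->
    [/\ forall i j, derivable (fun z : R => U z tau i j) y 1,
        forall i j, derivable (derive1n 1 (fun z : R => U z tau i j)) y 1,
        forall i j, derivable (fun t : R => U y t i j) tau 1
      & L U y tau = 0].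

(* E y tau y0 s --> delta (y - y0) 1%:M as tau --> s+: the integral operators
   with kernel E _ tau _ s tend to the identity on bounded continuous
   functions phi of y0, locally uniformly in y (joint limit in (y, tau)).  As
   this sees E only up to null sets of y0, continuity of the kernel in y0 is
   part of the condition; uniqueness of the fundamental solution would fail
   without it. *)
Definition delta_initial (R : realType) (d : nat) (T : R)
    (E : R -> R -> R -> R -> 'M[R]_d) : Prop :=
  (forall (i j : 'I_d) (y tau s : R), 0 <= s -> s < tau < T ->
     continuous (fun y0 : R => E y tau y0 s i j)) /\
  (forall (i j : 'I_d) (phi : R -> R) (s y : R), 0 <= s < T ->
     continuous phi -> (exists M : R, forall z, `|phi z| <= M) ->
     (fun p : R * R =>
        \int[@lebesgue_measure R]_(y0 in setT) (E p.1 p.2 y0 s i j * phi y0))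
       @ filter_prod (nbhs y) (at_right s) --> (i == j)%:R * phi y).

Definition gaussian_estimates (R : realType) (d : nat) (T : R)
    (E : R -> R -> R -> R -> 'M[R]_d) : Prop :=
  exists c C : R, [/\ 0 < c, 0 < C &
    forall (i j : 'I_d) (y tau y0 s : R), 0 <= s -> s < tau < T ->
      (forall k : nat, (k <= 2)%N ->
         `|dy k (fun z t => E z t y0 s) y tau i j|
           <= C * (tau - s) `^ (- (k.+1%:R / 2))
                * expR (- c * `|y - y0| ^+ 2 / (tau - s))) /\
      `|dtau (fun z t => E z t y0 s) y tau i j|
        <= C * (tau - s) `^ (- (3 / 2))
             * expR (- c * `|y - y0| ^+ 2 / (tau - s))].

(* E y tau y0 s is the value at (y, tau) of the kernel with pole (y0, s). *)
Definition fundamental_solution (R : realType) (d : nat) (T : R)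
    (L : (R -> R -> 'M[R]_d) -> R -> R -> 'M[R]_d)
    (E : R -> R -> R -> R -> 'M[R]_d) : Prop :=
  [/\ forall y0 s : R, 0 <= s < T ->
        classical_solution s T L (fun y tau => E y tau y0 s),
      delta_initial T E
    & gaussian_estimates T E].

(* Exponential series, summed entrywise: no assumption d > 0 is needed. *)
Definition expmx (R : realType) (d : nat) (A : 'M[R]_d) : 'M[R]_d :=
  \matrix_(i, j) limn (series (fun k : nat => (A ^+ k) i j / k`!%:R)).

Definition inf_mx (R : realType) (d : nat) (T : R) (B : R -> R -> 'M[R]_d) :
    'M[R]_d :=
  \matrix_(i, j)
    inf [set x : R | exists y tau : R, 0 <= tau <= T /\ x = B y tau i j].

Definition lower_bound (R : realType) (d : nat) (T eps0 : R) (Bs : 'M[R]_d)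
    (E : R -> R -> R -> R -> 'M[R]_d) (c C : R) : Prop :=
  forall (i j : 'I_d) (y y0 s tau : R), 0 <= s -> s < tau < T ->
    E y tau y0 s i j >=
      C * expmx ((c * (tau - s)) *: Bs) i j
        * (expR (- eps0 * (y - y0) ^+ 2 / (tau - s)) / Num.sqrt (tau - s)).

(* Main.v *)
(* For a Gaussian datum [gam(., s)], a heat kernel started at the pole [x] a
   little before [s], the columns [U] of the evolution of [E] solve
   [L_diag U = B U].  The maximum principle for cooperative systems gives
   [U >= 0].  If [psi_sg] is the evolution of [gam(., sg)] under [L_diag], then
   Aronson's bound and the convolution of Gaussians give [psi_sg >= c gam] with
   [c = delta0 sqrt (pi / eps0)].  Let [Bs] be the entrywise infimum of [B].  A
   lower bound [U >= c S(t - s) gam] with [S] a polynomial improves, by Duhamel's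
   principle, to [U >= c (1 + c int Bs S) gam]; from [S = 0] this generates the
   partial sums of [exp(c (t - s) Bs)].  Nothing is known about the measurability
   of the kernels in the initial time, so Duhamel's integral is replaced by
   Riemann sums, compared with [U] one time step at a time by the scalar maximum
   principle.  The pole is recovered by letting the datum concentrate at [x]. *)

Require Import Defs.
From HB Require Import structures.
From mathcomp Require Import all_boot all_order all_algebra.
From mathcomp Require Import all_classical all_reals all_analysis.
From mathcomp Require Import measurable_realfun ring lra.
Import Order.TTheory GRing.Theory Num.Theory.
Import numFieldNormedType.Exports.
Set Implicit Arguments.
Unset Strict Implicit.
Unset Printing Implicit Defensive.
Local Open Scope classical_set_scope.
Local Open Scope ring_scope.

(** In the initial time nothing is assumed, in the pole [y0] only continuity, and no semigroup
    identity is at hand. Every comparison is therefore made on the forward equation in (y, t), with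
    explicit sub- and supersolutions.

    [gam] does not solve the diagonal equation in general: [eps0] is not tied to the coefficients.
    Its merit is stability under Aronson's Gaussian. Convolving the two, with the same [eps0],
    returns a later slice of the same [gam] times the mass sqrt(pi / eps0), so each restart costs
    one factor [c] and no loss of shape. In the other direction, the bounded residual of [gam]
    yields psi_sg <= gam + K (t - sg). This makes the error of one time step quadratic in its
    length, so that the Riemann sums converge.

    Placing the pole at time [s - r] keeps [gam] and its derivatives bounded, hence [K] finite. No
    control of [K] as [r] tends to 0 is required, because the mesh is refined at fixed [r]. In the
    final limit the mass of the datum, again sqrt(pi / eps0), is divided out of [c], which leaves C
    = delta0. *)

(** * Derivative rules for functions written pointwise *)

Section pointwise_derivation.
Context {R : realType}.
Implicit Types (f g : R -> R) (x a b k : R).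

Lemma is_derive1_eq f x a b : is_derive x 1 f a -> a = b -> is_derive x 1 f b.
Proof. by move=> ? <-. Qed.

Lemma is_derive1_cst k x : is_derive x 1 (fun=> k) 0.
Proof. exact: is_derive_cst. Qed.

Lemma is_derive1_add f g x a b : is_derive x 1 f a -> is_derive x 1 g b ->
  is_derive x 1 (fun z => f z + g z) (a + b).
Proof. exact: is_deriveD. Qed.

Lemma is_derive1_scale k f x a : is_derive x 1 f a ->
  is_derive x 1 (fun z => k * f z) (k * a).
Proof. exact: is_deriveZ. Qed.

Lemma is_derive1_mul f g x a b : is_derive x 1 f a -> is_derive x 1 g b ->
  is_derive x 1 (fun z => f z * g z) (a * g x + f x * b).
Proof.
move=> fa gb; apply: is_derive1_eq (is_deriveM fa gb) _.
by rewrite /GRing.scale/= addrC mulrC.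
Qed.

Lemma is_derive1_expR f x a : is_derive x 1 f a ->
  is_derive x 1 (fun z => expR (f z)) (expR (f x) * a).
Proof. by move=> fa; exact: is_derive1_comp. Qed.

End pointwise_derivation.

(** * First- and second-order conditions at a minimum *)

Section local_minimum.
Context {R : realType}.

Lemma is_derive_linear_approx (f : R -> R) (x f' e : R) : 0 < e ->
  is_derive x 1 f f' -> exists2 rho : R, 0 < rho &
    forall h, `|h| < rho -> `|f (x + h) - f x - h * f'| <= e * `|h|.
Proof.
move=> e0 [df dfE].
have : (fun h : R => h^-1 *: (f (h *: (1:R) + x) - f x)) @ 0^' --> f'.
  by rewrite -dfE; exact: df.
move/cvgrPdist_lt/(_ _ e0) => [rho /= rho0 H]; exists rho => // h hr.
have [->|h0] := eqVneq h 0; first by rewrite addr0 subrr mul0r subr0 normr0 mulr0.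
have := H h; rewrite /= sub0r normrN => /(_ hr h0).
rewrite /GRing.scale/= mulr1 (addrC h) => K.
rewrite (_ : _ - _ = - (h * (f' - h^-1 * (f (x + h) - f x)))); last by field.
by rewrite normrN normrM mulrC ler_wpM2r// ltW.
Qed.

(** A positive slope would make [f] smaller just to the left of [x]. Only the left side is
    controlled because the minimum in the maximum principle may sit at the final time. *)
Lemma derive_left_min (f : R -> R) (x a f' : R) : a < x ->
  is_derive x 1 f f' -> (forall z, a < z < x -> f x <= f z) -> f' <= 0.
Proof.
move=> ax df fmin; rewrite leNgt; apply/negP => f'0.
have [//|rho rho0 H] := @is_derive_linear_approx f x f' (f' / 2) _ df; first lra.
pose m := Num.min rho (x - a).
have m0 : 0 < m by rewrite lt_min rho0 subr_gt0.
have m1 : m <= rho by rewrite ge_min lexx.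
have m2 : m <= x - a by rewrite ge_min lexx orbT.
have mh : `|- (m / 2)| = m / 2 by rewrite normrN gtr0_norm//; lra.
have /H : `|- (m / 2)| < rho by rewrite mh; lra.
have := fmin (x + - (m / 2)).
rewrite mh ler_norml => /(_ ltac:(lra)) K /andP[_].
have : 0 < m * f' by rewrite mulr_gt0.
lra.
Qed.

(** If [f2] were negative, [f1] would be negative just to the right of the critical point, and by
    the mean value theorem [f] would drop there. *)
Lemma derive2_min (f f1 : R -> R) (x r f2 : R) : 0 < r ->
  (forall z : R, is_derive z 1 f (f1 z)) -> is_derive x 1 f1 f2 ->
  (forall z, `|z - x| < r -> f x <= f z) -> f1 x = 0 /\ 0 <= f2.
Proof.
move=> r0 df df1 fmin.
have f1x : f1 x = 0.
  have xr : x \in `]x - r, x + r[ by rewrite in_itv/=; lra.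
  have [|||_ <-] := @derive1_at_min R f (x - r) (x + r) x _ _ xr _; first lra.
  - by move=> t _; case: (df t).
  - by move=> t; rewrite in_itv/= => t_; apply: fmin; rewrite ltr_norml; lra.
  - by case: (df x).
split => //; rewrite leNgt; apply/negP => f20.
have [//|rho rho0 H] := @is_derive_linear_approx f1 x f2 (- f2 / 2) _ df1; first lra.
pose m := Num.min rho r / 2.
have m0 : 0 < m by rewrite divr_gt0// lt_min rho0.
have mrho : Num.min rho r <= rho by rewrite ge_min lexx.
have mr : Num.min rho r <= r by rewrite ge_min lexx orbT.
have m1 : m < rho by rewrite /m; lra.
have m2 : m < r by rewrite /m; lra.
have cf : {within `[x, x + m], continuous f}.
  apply: continuous_subspaceT => z; apply: differentiable_continuous.
  by apply/derivable1_diffP; case: (df z).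
have xm : x < x + m by lra.
have [c + E] := MVT xm (fun z _ => df z) cf.
rewrite in_itv/= => /andP[xc cm].
have fm : f x <= f (x + m) by apply: fmin; rewrite addrAC subrr add0r gtr0_norm.
move: E; rewrite addrAC subrr add0r => E.
have : f1 c < 0.
  have := H (c - x); rewrite gtr0_norm ?subr_gt0// f1x subr0 subrKC.
  move=> /(_ ltac:(lra)); rewrite ler_norml => /andP[_ K].
  have : (c - x) * f2 < 0 by rewrite nmulr_llt0// subr_gt0.
  lra.
move=> f1c; have : f1 c * m < 0 by rewrite pmulr_llt0.
lra.
Qed.

End local_minimum.

(** * Maximum principle for cooperative parabolic systems *)

(** Zero-order and coupling terms are kept in the source [f]. Being a supersolution is then an
    inequality on [f], and sums and products with functions of time act on the pair (w, f).
    Boundedness and joint continuity are what the maximum principle needs to find a minimum on a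
    compact set. *)
Definition strip_solution (R : realType) (s T : R) (a2 a1 w f : R -> R -> R) :=
  [/\ exists N : R, forall y t, s < t < T -> `|w y t| <= N,
      forall y t, s < t < T ->
        {for (y, t), continuous (fun p : R * R => w p.1 p.2)}
    & exists wy wyy wt : R -> R -> R, forall y t : R, s < t < T ->
        [/\ is_derive y 1 (w ^~ t) (wy y t),
            is_derive y 1 (wy ^~ t) (wyy y t),
            is_derive t 1 (w y) (wt y t)
          & wt y t = a2 y t * wyy y t + a1 y t * wy y t + f y t]].

(** A lower limit at least 0 at each point of the initial line, with no uniformity in [y] and no
    value of [w] at time [s]. *)
Definition initially_ge0 (R : realType) (s : R) (w : R -> R -> R) :=
  forall (y eps : R), 0 < eps ->
    \forall p \near filter_prod (nbhs y) (at_right s), - eps < w p.1 p.2.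

Section maximum_principle.
Context {R : realType}.
Variables (s T M : R) (d : nat) (a2 a1 w f : 'I_d -> R -> R -> R).
Variable a0 : 'I_d -> 'I_d -> R -> R -> R.
Hypothesis a2_bnd : forall k y t, s < t < T -> 0 <= a2 k y t <= M.
Hypothesis a1_bnd : forall k y t, s < t < T -> `|a1 k y t| <= M.
Hypothesis a0_bnd : forall k l y t, s < t < T -> `|a0 k l y t| <= M.
Hypothesis a0_ge0 : forall k l y t, s < t < T -> k != l -> 0 <= a0 k l y t.
Hypothesis sol : forall k, strip_solution s T (a2 k) (a1 k) (w k) (f k).
Hypothesis f_ge : forall k y t, s < t < T ->
  \sum_l a0 k l y t * w l y t <= f k y t.
Hypothesis w_init : forall k, initially_ge0 s (w k).

(* The system is cooperative, so at a negative minimum over all components of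
   [exp(-lam (t - s)) w + eta (1 + y^2)] the coupling terms have the right
   sign. *)
Theorem cooperative_max_principle k y t : s < t < T -> 0 <= w k y t.
Proof.
move=> st; rewrite leNgt; apply/negP => wneg.
have M0 : 0 <= M by apply: le_trans (a1_bnd k y st); exact: normr_ge0.
(* With [P] the depth of the damped function at its minimum, coupling costs at most d M P, diffusion
   2 M P and drift M P. The final 1 makes the contradiction strict. *)
pose lam := (d%:R + 3) * M + 1.
pose Ex (u : R) := expR (- lam * (u - s)).
have lam0 : 0 <= lam by rewrite addr_ge0// mulr_ge0// addr_ge0.
have Ex0 u : 0 < Ex u by exact: expR_gt0.
have Ex1 u : s < u -> Ex u <= 1.
  by move=> su; rewrite /Ex -expR0 ler_expR mulNr oppr_le0 mulr_ge0// subr_ge0 ltW.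
have q0 (x : R) : 1 <= 1 + x ^+ 2 by rewrite lerDl sqr_ge0.
(* At (y, t) the penalty cancels exactly half of the negative value. *)
pose eta := - (Ex t * w k y t) / (2 * (1 + y ^+ 2)).
have eta0 : 0 < eta.
  rewrite divr_gt0// ?oppr_gt0 ?pmulr_rlt0// mulr_gt0//.
  by rewrite (lt_le_trans _ (q0 y)).
have etay : Ex t * w k y t + eta * (1 + y ^+ 2) < 0.
  have -> : eta * (1 + y ^+ 2) = - (Ex t * w k y t) / 2.
    rewrite /eta; field.
    by rewrite gt_eqF// (lt_le_trans _ (q0 y)).
  have : Ex t * w k y t < 0 by rewrite pmulr_rlt0.
  lra.
have [N N0 wN] : exists2 N, 0 <= N &
    forall k y t, s < t < T -> `|w k y t| <= N.
  have /choice[Nf HN] : forall k, exists N : R, forall y t,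
      s < t < T -> `|w k y t| <= N by move=> l; case: (sol l).
  exists (\sum_l `|Nf l|) => [|l x u su]; first exact: sumr_ge0.
  rewrite (le_trans (HN l x u su))// (bigD1 l)//= (le_trans (ler_norm _))//.
  by rewrite lerDl sumr_ge0.
(* Beyond [Y] the penalty exceeds the bound [N], so the minimum avoids the lateral boundary. *)
pose Y := `|y| + N / eta + 1.
have Neta : 0 <= N / eta by rewrite divr_ge0// ltW.
have Y1 : 1 <= Y by rewrite /Y -[X in X <= _]add0r lerD2r addr_ge0.
have yY : `|y| < Y by rewrite /Y -addrA ltrDl ltr_wpDl.
have etaY x : Y <= `|x| -> N < eta * (1 + x ^+ 2).
  move=> Yx; have : N / eta < 1 + x ^+ 2.
    rewrite -real_normK ?num_real//.
    have : `|x| <= `|x| ^+ 2 by rewrite expr2 ler_peMl// (le_trans Y1).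
    have : N / eta < Y by rewrite /Y -addrA addrCA ltrDl ltr_wpDl.
    lra.
  by rewrite ltr_pdivrMr// mulrC.
(* Compactness of the segment turns the pointwise initial condition into a bound at one time [s'].
   The tolerance [eta] is what the penalty compensates, so the minimum is not at [s'] either. *)
have [s' /andP[ss' s't] Hs'] : exists2 s', s < s' < t &
    forall x, x \in `[- Y, Y] -> forall l, - eta < w l x s'.
  have := (compact_near_coveringP _).1 (@segment_compact R (- Y) Y).
  move=> /(_ _ (at_right s) (fun u x => forall l, - eta < w l x u) _) H.
  have K : \forall u \near s^'+, forall x, x \in `[- Y, Y] -> forall l, - eta < w l x u.
    apply: H => x _.
    exact: (@filter_forall _ _ (fun l p => - eta < w l p.1 p.2) _ _
      (fun l => w_init l x eta0)).
  have : \forall u \near s^'+, [/\ s < u, u < t &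
      forall x, x \in `[- Y, Y] -> forall l, - eta < w l x u].
    near=> u; split; near: u => //.
      exact: nbhs_right_gt.
    by apply: nbhs_right_lt; case/andP: st.
  move=> /filter_ex[u [su ut Hu]]; exists u => //; exact/andP.
pose z l (p : R * R) := Ex p.2 * w l p.1 p.2 + eta * (1 + p.1 ^+ 2).
pose A := `[- Y, Y]%classic `*` `[s', t]%classic.
have AE p : A p <-> (- Y <= p.1 <= Y /\ s' <= p.2 <= t).
  by rewrite /A /setX/= !in_itv/=.
have Amem x u : `|x| <= Y -> s' <= u <= t -> A (x, u).
  by rewrite ler_norml => xY ut; apply/AE.
have Ayt : A (y, t) by apply: Amem; rewrite ?lexx ltW.
have Ast p : A p -> s < p.2 < T.
  by move=> /AE[_ /andP[H1 H2]]; case/andP: st => st1 st2; rewrite (lt_le_trans ss')//= (le_lt_trans H2).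
have A0 : A !=set0 by exists (y, t).
have cA : compact A by apply: compact_setX; exact: segment_compact.
have cz l : {within A, continuous (z l)}.
  apply: continuous_in_subspaceT => p /set_mem/Ast pst.
  have [_ cw _] := sol l.
  have cE : {for p, continuous (fun p : R * R => Ex p.2)}.
    rewrite /Ex; apply: (@continuous_cvg _ _ _ _ _ _ expR); first exact: continuous_expR.
    apply: cvgM; first exact: cvg_cst.
    by apply: cvgB; [exact: cvg_snd|exact: cvg_cst].
  rewrite /z; apply: cvgD.
    apply: cvgM; first exact: cE.
    by have := cw p.1 p.2 pst; rewrite -surjective_pairing.
  apply: cvgM; first exact: cvg_cst.
  apply: cvgD; first exact: cvg_cst.
  by apply: cvgM; exact: cvg_fst.
have /choice[c Hc] : forall l, exists c, A c /\ forall p, A p -> z l c <= z l p.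
  move=> l; have [c cAc H] := compact_EVT_min A0 cA (cz l).
  exists c; split; first exact: set_mem.
  by move=> p pA; apply: H; exact: mem_set.
have [k0 _ Hk0] := @arg_minP _ R _ k xpredT (fun i => z i (c i)) isT.
have [Ac _] := Hc k0; have cylt := Ast _ Ac.
have zmin l p : A p -> z k0 (c k0) <= z l p.
  by move=> Ap; apply: le_trans (Hk0 l isT) _; case: (Hc l) => _; exact.
have z0 : z k0 (c k0) < 0.
  by apply: le_lt_trans etay; exact: (zmin k (y, t)).
case: (c k0) Ac zmin z0 cylt => y0 t0 /= /AE/= [y0Y t0st] zmin z0 cylt.
rewrite /z/= in z0.
have /andP[st0 t0T] := cylt.
have y0Y' : `|y0| < Y.
  rewrite ltNge; apply/negP => /etaY.
  have := wN k0 y0 t0 cylt; have := Ex1 _ st0; have := Ex0 t0.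
  rewrite ler_norml => e0 e1 /andP[w0 _].
  have : - N <= Ex t0 * w k0 y0 t0.
    have : 0 <= Ex t0 * (w k0 y0 t0 + N) by rewrite mulr_ge0 ?(ltW e0)//; lra.
    have : 0 <= (1 - Ex t0) * N by rewrite mulr_ge0// subr_ge0.
    lra.
  by move: z0; lra.
have t0s' : s' < t0.
  rewrite lt_neqAle; case/andP: t0st => -> t0t; rewrite andbT.
  apply/eqP => E; have := Hs' y0 _ k0; rewrite /= in_itv/= E => /(_ y0Y) H.
  have := Ex1 _ st0; have := Ex0 t0; move=> e0 e1.
  have : 0 < Ex t0 * (w k0 y0 t0 + eta) by rewrite mulr_gt0//; lra.
  have : 0 <= (1 - Ex t0) * eta by rewrite mulr_ge0 ?(ltW eta0)// subr_ge0.
  have : 0 <= eta * y0 ^+ 2 by rewrite mulr_ge0 ?(ltW eta0)// sqr_ge0.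
  by move: z0; lra.
have [_ _ [wy [wyy [wt dw]]]] := sol k0.
have [_ _ dt0 pde] := dw y0 t0 cylt.
have [dy0 dyy0] : Ex t0 * wy y0 t0 + eta * (2 * y0) = 0 /\
    0 <= Ex t0 * wyy y0 t0 + eta * 2.
  have r0 : 0 < Y - `|y0| by rewrite subr_gt0.
  pose ff x := Ex t0 * w k0 x t0 + eta * (1 + x ^+ 2).
  pose ff1 x := Ex t0 * wy x t0 + eta * (2 * x).
  have dff (x : R) : is_derive x 1 ff (ff1 x).
    have [d1 _ _ _] := dw x t0 cylt.
    have dsq := is_derive1_mul (is_derive_id x 1) (is_derive_id x 1).
    apply: is_derive1_eq (is_derive1_add (is_derive1_scale (Ex t0) d1)
      (is_derive1_scale eta (is_derive1_add (is_derive1_cst 1 x) dsq))) _.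
    by rewrite /ff1; ring.
  have dff1 : is_derive y0 1 ff1 (Ex t0 * wyy y0 t0 + eta * 2).
    have [_ d2 _ _] := dw y0 t0 cylt.
    apply: is_derive1_eq (is_derive1_add (is_derive1_scale (Ex t0) d2)
      (is_derive1_scale eta (is_derive1_scale 2 (is_derive_id y0 1)))) _.
    by ring.
  apply: (derive2_min r0 dff dff1) => x xr.
  apply: (zmin k0 (x, t0)); apply: Amem => //.
    have := ler_normD (x - y0) y0; rewrite subrK => H.
    by apply: (le_trans H); move: xr; lra.
have dt : Ex t0 * wt y0 t0 <= lam * (Ex t0 * w k0 y0 t0).
  pose ff u := Ex u * w k0 y0 u + eta * (1 + y0 ^+ 2).
  have dff : is_derive t0 1 ff (Ex t0 * wt y0 t0 - lam * (Ex t0 * w k0 y0 t0)).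
    have dE := is_derive1_expR (is_derive1_scale (- lam)
      (is_derive1_add (is_derive_id t0 1) (is_derive1_cst (- s) t0))).
    apply: is_derive1_eq (is_derive1_add (is_derive1_mul dE dt0)
      (is_derive1_cst (eta * (1 + y0 ^+ 2)) t0)) _.
    by rewrite /Ex; ring.
  rewrite -subr_le0; apply: (derive_left_min t0s' dff) => u /andP[s'u ut0].
  apply: (zmin k0 (y0, u)); apply: Amem; first exact: ltW.
  by case/andP: t0st => _ t0t; apply/andP; split; lra.
(* Negativity of the minimum says eta (1 + y0^2) < P, so every term produced by the penalty is
   absorbed by [P]. *)
pose P := - (Ex t0 * w k0 y0 t0).
have etaq : eta * (1 + y0 ^+ 2) < P by rewrite /P; lra.
have etaP : eta <= P.
  by apply: le_trans (ltW etaq); rewrite ler_peMr// ltW.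
have P0 : 0 < P by exact: lt_le_trans etaP.
have WP l : - P <= Ex t0 * w l y0 t0.
  have : z k0 (y0, t0) <= z l (y0, t0) by apply: zmin; apply: Amem => //; exact: ltW.
  by rewrite /z/= /P; lra.
have sumP : - (d%:R * M * P) <= Ex t0 * f k0 y0 t0.
  apply: (@le_trans _ _ (Ex t0 * \sum_l a0 k0 l y0 t0 * w l y0 t0)); last first.
    by rewrite ler_wpM2l ?(ltW (Ex0 _))// f_ge.
  rewrite mulr_sumr (_ : - (d%:R * M * P) = \sum_(l < d) - (M * P)); last first.
    by rewrite sumr_const card_ord -mulr_natr; ring.
  apply: ler_sum => l _; rewrite mulrCA.
  have := a0_bnd k0 l y0 cylt; rewrite ler_norml => /andP[aM1 aM2].
  have [<-|kl] := eqVneq k0 l.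
    have -> : a0 k0 k0 y0 t0 * (Ex t0 * w k0 y0 t0) = - (a0 k0 k0 y0 t0 * P).
      by rewrite /P; ring.
    rewrite lerN2; apply: ler_wpM2r; first exact: ltW.
    exact: le_trans (ler_norm _) (a0_bnd k0 k0 y0 cylt).
  have a00 := a0_ge0 y0 cylt kl.
  have : 0 <= a0 k0 l y0 t0 * (Ex t0 * w l y0 t0 + P).
    by rewrite mulr_ge0//; have := WP l; lra.
  have : 0 <= (M - a0 k0 l y0 t0) * P by rewrite mulr_ge0 ?(ltW P0)// subr_ge0.
  lra.
have a2P : - (2 * (M * P)) <= Ex t0 * (a2 k0 y0 t0 * wyy y0 t0).
  have /andP[a20 a2M] := a2_bnd k0 y0 cylt.
  have : 0 <= a2 k0 y0 t0 * (Ex t0 * wyy y0 t0 + eta * 2) by rewrite mulr_ge0.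
  have : 0 <= (M - a2 k0 y0 t0) * eta by rewrite mulr_ge0 ?(ltW eta0)// subr_ge0.
  have : 0 <= M * (P - eta) by rewrite mulr_ge0// subr_ge0.
  lra.
(* The first-order condition replaces the gradient by - 2 eta y0, and 2 |y0| <= 1 + y0^2. *)
have a1P : - (M * P) <= Ex t0 * (a1 k0 y0 t0 * wy y0 t0).
  have -> : Ex t0 * (a1 k0 y0 t0 * wy y0 t0) = - (a1 k0 y0 t0 * (eta * (2 * y0))).
    have -> : eta * (2 * y0) = - (Ex t0 * wy y0 t0) by lra.
    ring.
  rewrite lerN2 (le_trans (ler_norm _))// normrM.
  apply: ler_pM => //; first exact: a1_bnd.
  apply: le_trans (ltW etaq); rewrite normrM (gtr0_norm eta0) ler_wpM2l ?(ltW eta0)//.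
  have : 0 <= (`|y0| - 1) ^+ 2 by rewrite sqr_ge0.
  rewrite normrM ger0_norm// sqrrB real_normK ?num_real//; lra.
move: dt; rewrite pde !mulrDr -[X in lam * X]opprK -/P mulrN => dt.
have : lam * P = d%:R * M * P + 3 * (M * P) + P by rewrite /lam; ring.
lra.
Unshelve. all: by end_near. Qed.

End maximum_principle.

(** * Integrals with Gaussian kernels *)

Section gaussian_integrals.
Context {R : realType}.
Notation mu := (@lebesgue_measure R).
Implicit Types (a m K x : R) (f g : R -> R).

(** A rescaled normal density of variance 1 / (2 a): integrability and total mass follow from those
    of the normal law. *)
Lemma gaussian_normal_pdf a m : 0 < a ->
  (fun z => expR (- (a * (z - m) ^+ 2))) =
  (fun z => Num.sqrt (a^-1 * pi) * normal_pdf m (Num.sqrt (2 * a)^-1) z).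
Proof.
move=> a0; have s0 : Num.sqrt (2 * a)^-1 != 0.
  by rewrite gt_eqF// sqrtr_gt0 invr_gt0 mulr_gt0.
apply/funext => z; rewrite normal_pdfE// /normal_peak /normal_fun.
rewrite sqr_sqrtr ?invr_ge0 ?mulr_ge0 ?(ltW a0)//.
rewrite (_ : (2 * a)^-1 * pi *+ 2 = a^-1 * pi); last first.
  by rewrite -mulr_natr; field; rewrite gt_eqF.
rewrite mulVKf; last by rewrite gt_eqF// sqrtr_gt0 mulr_gt0 ?invr_gt0 ?pi_gt0.
by congr expR; rewrite -mulr_natr; field; rewrite gt_eqF.
Qed.

Lemma integrable_gaussian a m : 0 < a ->
  mu.-integrable setT (EFin \o (fun z => expR (- (a * (z - m) ^+ 2)))).
Proof.
move=> a0; rewrite gaussian_normal_pdf//.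
have := @integrableZl _ _ _ mu _ measurableT (Num.sqrt (a^-1 * pi)) _
  (integrable_normal_pdf m (Num.sqrt (2 * a)^-1)).
by apply: eq_integrable => // z _; rewrite /= EFinM.
Qed.

Lemma Rintegral_gaussian a m : 0 < a ->
  \int[mu]_(z in setT) expR (- (a * (z - m) ^+ 2)) = Num.sqrt (a^-1 * pi).
Proof.
move=> a0; rewrite (@eq_Rintegral _ _ _ mu _
  (fun z => Num.sqrt (a^-1 * pi) * normal_pdf m (Num.sqrt (2 * a)^-1) z)).
  rewrite RintegralZl//; last exact: integrable_normal_pdf.
  by rewrite /Rintegral integral_normal_pdf mulr1.
by move=> z _; exact: (congr1 (fun h => h z) (gaussian_normal_pdf m a0)).
Qed.

Lemma integrable_le_gaussian a m K f : 0 < a -> measurable_fun setT f ->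
  (forall z, `|f z| <= K * expR (- (a * (z - m) ^+ 2))) ->
  mu.-integrable setT (EFin \o f).
Proof.
move=> a0 mf fK.
have iK : mu.-integrable setT (fun z => K%:E * (expR (- (a * (z - m) ^+ 2)))%:E)%E.
  apply: integrableZl => //; exact: integrable_gaussian.
apply: le_integrable iK => //; first exact/measurable_EFinP.
move=> z _ /=; rewrite lee_fin; apply: le_trans (fK z) _.
exact: ler_norm.
Qed.

Lemma Rintegral_le_gaussian a m K f : 0 < a -> measurable_fun setT f ->
  (forall z, `|f z| <= K * expR (- (a * (z - m) ^+ 2))) ->
  `|\int[mu]_(z in setT) f z| <= K * Num.sqrt (a^-1 * pi).
Proof.
move=> a0 mf fK; have intf := integrable_le_gaussian a0 mf fK.
apply: le_trans (le_normr_Rintegral measurableT intf) _.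
rewrite -(Rintegral_gaussian m a0) -RintegralZl//; last exact: integrable_gaussian.
apply: le_Rintegral => //; first exact: integrable_norm.
apply: (@integrable_le_gaussian a m `|K|) => //.
  apply: measurable_funM => //; apply/measurable_EFinP.
  by case/integrableP: (integrable_gaussian m a0).
by move=> z; rewrite normrM (ger0_norm (expR_ge0 _)).
Qed.

(** A derivative in the parameter is a pointwise limit of measurable difference quotients. This
    gives measurability in the pole for derivatives of kernels, about which only bounds are
    assumed. *)
Lemma measurable_derive (g : R -> R -> R) (g' : R -> R) (u r : R) : 0 < r ->
  (forall v, `|v - u| < r -> measurable_fun setT (g v)) ->
  (forall z, is_derive u 1 (g ^~ z) (g' z)) -> measurable_fun setT g'.
Proof.
move=> r0 mg dg; pose q n : R := r / 2 * n.+1%:R^-1.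
have q0 n : 0 < q n by rewrite /q mulr_gt0 ?divr_gt0// invr_gt0.
have qr n : q n < r.
  rewrite /q ltr_pdivrMr//; have : (1 : R) <= n.+1%:R by rewrite ler1n.
  move=> n1; have : r * 1 <= r * n.+1%:R by rewrite ler_wpM2l// ltW.
  lra.
apply: (@measurable_fun_cvg _ _ _ _
  (fun n z => (q n)^-1 * (g (u + q n) z - g u z))).
  move=> n; apply: measurable_funM => //.
  apply: measurable_funB; apply: mg; rewrite ?subrr ?normr0//.
  by rewrite addrC addKr gtr0_norm.
move=> z _; apply/cvgrPdist_le => e e0.
have [rho rho0 H] := is_derive_linear_approx e0 (dg z).
have rr0 : 0 < rho / (r / 2) by rewrite !divr_gt0.
have [N _ HN] : \forall n \near \oo, (n.+1%:R^-1 : R) < rho / (r / 2).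
  exact: near_infty_natSinv_lt (PosNum rr0).
exists N => // n /HN nr /=.
have qrho : q n < rho by rewrite /q mulrC -ltr_pdivlMr ?divr_gt0.
have := H (q n); rewrite gtr0_norm// => /(_ qrho) K.
rewrite distrC (_ : _ - _ = (q n)^-1 *
  (g (u + q n) z - g u z - q n * g' z)); last by field; rewrite gt_eqF.
by rewrite normrM gtr0_norm ?invr_gt0// mulrC ler_pdivrMr.
Qed.

Lemma is_derive_Rintegral (g g' : R -> R -> R) (u r a m K : R) :
  0 < r -> 0 < a -> (forall v, `|v - u| < r -> measurable_fun setT (g v)) ->
  (forall v z, `|v - u| < r -> is_derive v 1 (g ^~ z) (g' v z)) ->
  (forall v z, `|v - u| < r -> `|g v z| <= K * expR (- (a * (z - m) ^+ 2))) ->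
  (forall v z, `|v - u| < r -> `|g' v z| <= K * expR (- (a * (z - m) ^+ 2))) ->
  is_derive u 1 (fun v => \int[mu]_(z in setT) g v z)
    (\int[mu]_(z in setT) g' u z).
Proof.
move=> r0 a0 mg dg gK g'K.
pose I : set R := `]u - r, u + r[%classic.
have IE v : I v -> `|v - u| < r by rewrite /I/= in_itv/= ltr_norml; lra.
have Iu : I u by rewrite /I/= in_itv/=; lra.
have K0 : 0 <= K.
  have := gK u m; rewrite !subrr normr0 => /(_ r0).
  by rewrite expr0n/= mulr0 oppr0 expR0 mulr1; apply: le_trans.
have intf x : I x -> mu.-integrable setT (EFin \o g x).
  by move=> /IE ux; apply: (integrable_le_gaussian a0 (mg _ ux)) => z; exact: gK.
have derf x z : I x -> [set: R] z -> derivable (g ^~ z) x 1.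
  by move=> /IE ux _; case: (dg x z ux).
have d1E x z : I x -> partial1of2 g x z = g' x z.
  by move=> /IE ux; rewrite partial1of2E; case: (dg x z ux).
pose G z := K * expR (- (a * (z - m) ^+ 2)).
have G0 z : 0 <= G z by rewrite mulr_ge0// expR_ge0.
have intG : mu.-integrable setT (EFin \o G).
  apply: (@integrable_le_gaussian a m K) => //.
    apply: measurable_funM => //; apply/measurable_EFinP.
    by case/integrableP: (integrable_gaussian m a0).
  by move=> z; rewrite ger0_norm.
have Gub x z : I x -> [set: R] z -> `|partial1of2 g x z| <= G z.
  by move=> Ix _; rewrite d1E//; exact/g'K/IE.
have der := derivable_under_integral measurableT Iu intf derf G0 intG Gub.
have derE := differentiation_under_integral measurableT Iu intf derf G0 intG Gub.
apply: DeriveDef => //; rewrite -derive1E derE.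
by apply: eq_Rintegral => z _; rewrite d1E.
Qed.

Lemma Rintegral_sum n (h : 'I_n -> R -> R) :
  (forall i, mu.-integrable setT (EFin \o h i)) ->
  mu.-integrable setT (EFin \o (fun z => \sum_i h i z)) /\
  \int[mu]_(z in setT) (\sum_i h i z) = \sum_i \int[mu]_(z in setT) h i z.
Proof.
elim: n h => [|n IH] h ih.
  under eq_Rintegral do rewrite big_ord0.
  rewrite big_ord0 (_ : (fun z => _) = cst 0); last first.
    by apply/funext => z; rewrite big_ord0.
  split; first exact: integrable0.
  by rewrite Rintegral_cst ?mul0r.
have [i1 E1] := IH (fun i => h (lift ord0 i)) (fun i => ih _).
have -> : (fun z => \sum_i h i z) = (fun z => h ord0 z + \sum_i h (lift ord0 i) z).
  by apply/funext => z; rewrite big_ord_recl.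
split; first by have := integrableD measurableT (ih ord0) i1.
by rewrite RintegralD// big_ord_recl E1.
Qed.

End gaussian_integrals.

(** * Joint continuity from bounded partial derivatives *)

Section joint_continuity.
Context {R : realType}.

Lemma derive_bounded_lipschitz (f f' : R -> R) (a b L : R) :
  (forall z : R, Num.min a b <= z <= Num.max a b -> is_derive z 1 f (f' z)) ->
  (forall z, Num.min a b <= z <= Num.max a b -> `|f' z| <= L) ->
  `|f b - f a| <= L * `|b - a|.
Proof.
wlog ab : a b / a <= b.
  move=> H df fL; have [ab|/ltW ba] := leP a b; first exact: H.
  rewrite distrC (distrC b); apply: H => // z zab; [apply: df|apply: fL];
    by rewrite minC maxC.
rewrite (min_idPl ab) (max_idPr ab) => df fL.
have cf : {within `[a, b], continuous f}.
  apply: derivable_within_continuous => z; rewrite in_itv/= => /df dz.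
  by case: dz.
have [c cab ->] := MVT_segment ab (fun z zab => df z (subset_itv_oo_cc zab)) cf.
rewrite normrM ler_wpM2r//; apply: fL.
by move: cab; rewrite in_itv.
Qed.

(** The increment splits into a time step at fixed [y0] and a space step at fixed [t], each
    Lipschitz with constant [L]. *)
Lemma continuous_bounded_partials (F Fy Ft : R -> R -> R) (y0 t0 r L : R) :
  0 < r ->
  (forall y t : R, `|t - t0| < r -> is_derive y 1 (F ^~ t) (Fy y t)) ->
  (forall y t : R, `|t - t0| < r -> is_derive t 1 (F y) (Ft y t)) ->
  (forall y t, `|t - t0| < r -> `|Fy y t| <= L) ->
  (forall y t, `|t - t0| < r -> `|Ft y t| <= L) ->
  {for (y0, t0), continuous (fun p : R * R => F p.1 p.2)}.
Proof.
move=> r0 dy dt Ly Lt; apply/cvgrPdist_le => e e0 /=.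
have L0 : 0 <= L by apply: le_trans (Ly y0 t0 _); rewrite ?subrr ?normr0.
pose del := Num.min r (e / (2 * (L + 1))).
have e1 : 0 < e / (2 * (L + 1)) by rewrite divr_gt0// mulr_gt0//; lra.
have del0 : 0 < del by rewrite lt_min r0 e1.
have delr : del <= r by rewrite ge_min lexx.
have dele : del <= e / (2 * (L + 1)) by rewrite ge_min lexx orbT.
exists (ball y0 del, ball t0 del) => [|[y t] /= []].
  by split; exact: nbhsx_ballx.
rewrite /ball/= => yd td.
have tr u : Num.min t t0 <= u <= Num.max t t0 -> `|u - t0| < r.
  move: td; rewrite ge_min le_max !ltr_norml => td /andP[/orP[]? /orP[]?]; lra.
have H1 : `|F y0 t0 - F y0 t| <= L * `|t0 - t|.
  apply: (derive_bounded_lipschitz (f' := Ft y0)) => u /tr ur; first exact: dt.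
  exact: Lt.
have H2 : `|F y0 t - F y t| <= L * `|y0 - y|.
  have tt : `|t - t0| < r by rewrite distrC (lt_le_trans td).
  apply: (derive_bounded_lipschitz (f := F ^~ t) (f' := Fy ^~ t)) => u _.
    exact: dy.
  exact: Ly.
rewrite (_ : _ - _ = (F y0 t0 - F y0 t) + (F y0 t - F y t)); last by ring.
rewrite (le_trans (ler_normD _ _))// (le_trans (lerD H1 H2))//.
rewrite -mulrDr; have L1 : 0 < L + 1 by lra.
apply: (@le_trans _ _ ((L + 1) * (2 * (e / (2 * (L + 1)))))).
  by apply: ler_pM => //; lra.
by rewrite le_eqVlt; apply/orP; left; apply/eqP; field; rewrite gt_eqF.
Qed.

End joint_continuity.

(** * Integrals of a kernel against a bounded continuous datum *)

Section kernel_integrals.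
Context {R : realType}.
Notation mu := (@lebesgue_measure R).
Variables (s T Mphi : R) (k ky kyy kt : R -> R -> R -> R) (phi : R -> R).
Hypothesis k_cont : forall y t, s < t < T -> continuous (k y t).
Hypothesis k_dy : forall y t z : R, s < t < T ->
  is_derive y 1 (fun v => k v t z) (ky y t z).
Hypothesis k_dyy : forall y t z : R, s < t < T ->
  is_derive y 1 (fun v => ky v t z) (kyy y t z).
Hypothesis k_dt : forall y t z : R, s < t < T ->
  is_derive t 1 (fun v => k y v z) (kt y t z).
Hypothesis k_bnd : forall t0, s < t0 -> exists K a : R, 0 < a /\
  forall y t z, t0 <= t < T ->
    [/\ `|k y t z| <= K * expR (- (a * (z - y) ^+ 2)),
        `|ky y t z| <= K * expR (- (a * (z - y) ^+ 2)),
        `|kyy y t z| <= K * expR (- (a * (z - y) ^+ 2))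
      & `|kt y t z| <= K * expR (- (a * (z - y) ^+ 2))].
Hypothesis phi_cont : continuous phi.
Hypothesis phi_bnd : forall z, `|phi z| <= Mphi.

(** From (z - y0)^2 <= 2 (z - y)^2 + 2 (y - y0)^2. Half the rate buys a single dominating Gaussian
    for all centres within distance 1 of [y0]. *)
Lemma gaussian_shift (a y y0 z : R) : 0 < a -> `|y - y0| < 1 ->
  expR (- (a * (z - y) ^+ 2)) <= expR a * expR (- (a / 2 * (z - y0) ^+ 2)).
Proof.
move=> a0 yy0; rewrite -expRD ler_expR.
have : (y - y0) ^+ 2 <= 1.
  by rewrite -real_normK ?num_real// expr_le1// ltW.
move=> y1; have : 0 <= a * (1 - (y - y0) ^+ 2) by rewrite mulr_ge0 ?(ltW a0)//; lra.
have : 0 <= a * (z - y - (y - y0)) ^+ 2 by rewrite mulr_ge0 ?(ltW a0)// sqr_ge0.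
rewrite !expr2; lra.
Qed.

Let Mphi0 : 0 <= Mphi. Proof. exact: le_trans (phi_bnd 0). Qed.

Let mphi : measurable_fun setT phi.
Proof. exact: continuous_measurable_fun. Qed.

Let mk y t : s < t < T -> measurable_fun setT (k y t).
Proof. by move=> st; apply: continuous_measurable_fun; exact: k_cont. Qed.

Let mky y t : s < t < T -> measurable_fun setT (ky y t).
Proof.
move=> st; apply: (@measurable_derive R (fun v z => k v t z) _ y 1) => // [v _|z].
  exact: mk.
exact: k_dy.
Qed.

Let mkyy y t : s < t < T -> measurable_fun setT (kyy y t).
Proof.
move=> st; apply: (@measurable_derive R (fun v z => ky v t z) _ y 1) => // [v _|z].
  exact: mky.
exact: k_dyy.
Qed.

(** Within this radius of [t], times stay below [T] and above (s + t) / 2, where one pair of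
    constants from [k_bnd] serves. *)
Let margin t := Num.min ((t - s) / 2) (T - t).

Let margin0 t : s < t < T -> 0 < margin t.
Proof. by move=> st; rewrite lt_min; apply/andP; split; lra. Qed.

Let marginP t v : s < t < T -> `|v - t| < margin t -> (s + t) / 2 <= v < T.
Proof. by move=> st; rewrite lt_min ltr_norml ltr_norml => ?; lra. Qed.

Let marginW t v : s < t < T -> `|v - t| < margin t -> s < v < T.
Proof. by move=> st /(marginP st); lra. Qed.

Let mkt y t : s < t < T -> measurable_fun setT (kt y t).
Proof.
move=> st.
apply: (@measurable_derive R (fun v z => k y v z) _ t _ (margin0 st)) => [v vt|z].
  exact: mk (marginW st vt).
exact: k_dt.
Qed.

Lemma bound_mul_phi (x K g z : R) : `|x| <= K * g -> `|x * phi z| <= K * Mphi * g.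
Proof.
by move=> xK; rewrite normrM mulrAC; apply: ler_pM.
Qed.

Let P (h : R -> R -> R -> R) y t := \int[mu]_(z in setT) (h y t z * phi z).

Let mM (f : R -> R) : measurable_fun setT f ->
  measurable_fun setT (fun z => f z * phi z).
Proof. by move=> mf; exact: measurable_funM. Qed.

Lemma kernel_integrable y t : s < t < T ->
  [/\ mu.-integrable setT (EFin \o (fun z => k y t z * phi z)),
      mu.-integrable setT (EFin \o (fun z => ky y t z * phi z)),
      mu.-integrable setT (EFin \o (fun z => kyy y t z * phi z))
    & mu.-integrable setT (EFin \o (fun z => kt y t z * phi z))].
Proof.
move=> st; have /andP[s_t tT] := st; have [K [a [a0 H]]] := k_bnd s_t.
have tt : t <= t < T by rewrite lexx.
split; apply: (@integrable_le_gaussian R a y (K * Mphi) _ a0) => [|z].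
- by apply: mM; exact: mk.
- by have [B _ _ _] := H y t z tt; exact: bound_mul_phi.
- by apply: mM; exact: mky.
- by have [_ B _ _] := H y t z tt; exact: bound_mul_phi.
- by apply: mM; exact: mkyy.
- by have [_ _ B _] := H y t z tt; exact: bound_mul_phi.
- by apply: mM; exact: mkt.
- by have [_ _ _ B] := H y t z tt; exact: bound_mul_phi.
Qed.

(** Differentiation under the integral sign. Varying [y] moves the centre of the bounding Gaussian,
    hence the shift; varying [t] keeps the centre and only has to stay away from [s]. *)
Lemma kernel_derivatives (y t : R) : s < t < T ->
  [/\ is_derive y 1 ((P k) ^~ t) (P ky y t),
      is_derive y 1 ((P ky) ^~ t) (P kyy y t)
    & is_derive t 1 (P k y) (P kt y t)].
Proof.
move=> st; have /andP[s_t tT] := st.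
have st2 : s < (s + t) / 2 by lra.
have [K [a [a0 H]]] := k_bnd st2.
have tt : (s + t) / 2 <= t < T by lra.
have a20 : 0 < a / 2 by lra.
have shift v z x : `|v - y| < 1 -> `|x| <= K * expR (- (a * (z - v) ^+ 2)) ->
    `|x * phi z| <= K * expR a * Mphi * expR (- (a / 2 * (z - y) ^+ 2)).
  move=> vy xK; apply: bound_mul_phi; apply: le_trans xK _.
  have K0 : 0 <= K.
    have [+ _ _ _] := H 0 t 0 tt.
    rewrite subrr expr0n/= mulr0 oppr0 expR0 mulr1; exact: le_trans.
  by rewrite -mulrA ler_wpM2l//; exact: gaussian_shift.
have dM (g : R -> R) (u g' c : R) : is_derive u 1 g g' ->
    is_derive u 1 (fun v => g v * c) (g' * c).
  move=> dg; apply: is_derive1_eq (is_derive1_mul dg (is_derive1_cst c u)) _.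
  by rewrite mulr0 addr0.
split.
- apply: (@is_derive_Rintegral R (fun v z => k v t z * phi z)
    (fun v z => ky v t z * phi z) y 1 (a / 2) y _ ltr01 a20).
  + by move=> v _; apply: mM; exact: mk.
  + by move=> v z _; apply: dM; exact: k_dy.
  + by move=> v z vy; have [B _ _ _] := H v t z tt; exact: shift vy B.
  + by move=> v z vy; have [_ B _ _] := H v t z tt; exact: shift vy B.
- apply: (@is_derive_Rintegral R (fun v z => ky v t z * phi z)
    (fun v z => kyy v t z * phi z) y 1 (a / 2) y _ ltr01 a20).
  + by move=> v _; apply: mM; exact: mky.
  + by move=> v z _; apply: dM; exact: k_dyy.
  + by move=> v z vy; have [_ B _ _] := H v t z tt; exact: shift vy B.
  + by move=> v z vy; have [_ _ B _] := H v t z tt; exact: shift vy B.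
- apply: (@is_derive_Rintegral R (fun v z => k y v z * phi z)
    (fun v z => kt y v z * phi z) t _ a y (K * Mphi) (margin0 st) a0).
  + by move=> v vt; apply: mM; apply: mk; apply: (marginW st).
  + by move=> v z vt; apply: dM; apply: k_dt; exact: marginW vt.
  + move=> v z vt; have [B _ _ _] := H y v z (marginP st vt).
    exact: bound_mul_phi.
  + move=> v z vt; have [_ _ _ B] := H y v z (marginP st vt).
    exact: bound_mul_phi.
Qed.

Lemma kernel_continuous (y t : R) : s < t < T ->
  {for (y, t), continuous (fun p : R * R => P k p.1 p.2)}.
Proof.
move=> st; have /andP[s_t tT] := st.
have st2 : s < (s + t) / 2 by lra.
have [K [a [a0 H]]] := k_bnd st2.
apply: (@continuous_bounded_partials R (P k) (P ky) (P kt) y t (margin t)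
    (K * Mphi * Num.sqrt (a^-1 * pi)) (margin0 st)) => v u ut.
- by have [] := kernel_derivatives v (marginW st ut).
- by have [] := kernel_derivatives v (marginW st ut).
- apply: (@Rintegral_le_gaussian R a v _ _ a0).
    by apply: mM; apply: mky; apply: (marginW st).
  move=> z; have [_ B _ _] := H v u z (marginP st ut); exact: bound_mul_phi.
- apply: (@Rintegral_le_gaussian R a v _ _ a0).
    by apply: mM; apply: mkt; apply: (marginW st).
  move=> z; have [_ _ _ B] := H v u z (marginP st ut); exact: bound_mul_phi.
Qed.

End kernel_integrals.

(** * Calculus of strip solutions and of their initial behaviour *)

Section strip_solution_theory.
Context {R : realType}.
Implicit Types (s T M : R) (w f : R -> R -> R) (p : R -> R).

Lemma strip_solution_sub s s' T a2 a1 w f : s <= s' ->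
  strip_solution s T a2 a1 w f -> strip_solution s' T a2 a1 w f.
Proof.
move=> ss' [[N HN] cw [wy [wyy [wt H]]]].
have st y : s' < y < T -> s < y < T.
  by move=> /andP[sy ->]; rewrite (le_lt_trans ss').
split; [exists N => y t /st|move=> y t /st|exists wy, wyy, wt => y t /st].
- exact: HN.
- exact: cw.
- exact: H.
Qed.

Lemma strip_solution_eq s T a2 a1 w f w' f' : (forall y t, w y t = w' y t) ->
  (forall y t, s < t < T -> f y t = f' y t) ->
  strip_solution s T a2 a1 w f -> strip_solution s T a2 a1 w' f'.
Proof.
move=> ww ff; have -> : w' = w by apply/funext => y; apply/funext => t.
move=> [HN cw [wy [wyy [wt H]]]]; split => //; exists wy, wyy, wt => y t st.
by rewrite -ff//; exact: H.
Qed.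

(** Functions of time alone are the barriers and error terms of the comparisons below. *)
Lemma strip_solution_time s T a2 a1 p p' N :
  (forall t : R, s < t < T -> is_derive t 1 p (p' t)) ->
  (forall t, s < t < T -> `|p t| <= N) ->
  strip_solution s T a2 a1 (fun=> p) (fun=> p').
Proof.
move=> dp pN; split.
- by exists N => y t; exact: pN.
- move=> y t /dp dpt.
  have cp : {for t, continuous p}.
    by apply: differentiable_continuous; apply/derivable1_diffP; case: dpt.
  apply: (@continuous_cvg _ _ _ _ _ snd p) => //; exact: cvg_snd.
- exists (fun _ _ => 0), (fun _ _ => 0), (fun=> p') => y t st; split.
  + exact: is_derive1_cst.
  + exact: is_derive1_cst.
  + exact: dp.
  + by rewrite !mulr0 !add0r.
Qed.

(** The product rule adds p' w to the source. With [p] affine in time, this is the term that a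
    Duhamel step plays against the source. *)
Lemma strip_solution_lincomb s T a2 a1 p p' N w f w1 f1 :
  (forall t : R, s < t < T -> is_derive t 1 p (p' t)) ->
  (forall t, s < t < T -> `|p t| <= N) ->
  strip_solution s T a2 a1 w f -> strip_solution s T a2 a1 w1 f1 ->
  strip_solution s T a2 a1 (fun y t => p t * w y t + w1 y t)
    (fun y t => p t * f y t + p' t * w y t + f1 y t).
Proof.
move=> dp pN [[Nw HN] cw [wy [wyy [wt H]]]] [[Nw1 HN1] cw1 [w1y [w1yy [w1t H1]]]].
split.
- exists (N * Nw + Nw1) => y t st.
  rewrite (le_trans (ler_normD _ _))// lerD// ?HN1// normrM.
  by apply: ler_pM => //; [exact: pN|exact: HN].
- move=> y t st.
  have cp : {for t, continuous p}.
    by apply: differentiable_continuous; apply/derivable1_diffP; case: (dp t st).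
  apply: cvgD; last exact: cw1.
  apply: cvgM; last exact: cw.
  by apply: (@continuous_cvg _ _ _ _ _ snd p) => //; exact: cvg_snd.
- exists (fun y t => p t * wy y t + w1y y t),
    (fun y t => p t * wyy y t + w1yy y t),
    (fun y t => p' t * w y t + p t * wt y t + w1t y t) => y t st.
  have [d1 d2 d3 E] := H y t st; have [d11 d12 d13 E1] := H1 y t st.
  split.
  + by apply: is_derive1_add => //; exact: is_derive1_scale.
  + by apply: is_derive1_add => //; exact: is_derive1_scale.
  + by apply: is_derive1_add => //; apply: is_derive1_mul => //; exact: dp.
  + by rewrite E E1; ring.
Qed.

Lemma strip_solution_scale_add s T a2 a1 (c : R) w f w1 f1 :
  strip_solution s T a2 a1 w f -> strip_solution s T a2 a1 w1 f1 ->
  strip_solution s T a2 a1 (fun y t => c * w y t + w1 y t)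
    (fun y t => c * f y t + f1 y t).
Proof.
move=> sw sw1.
have dc (t : R) : s < t < T -> is_derive t 1 (fun=> c) 0.
  by move=> _; exact: is_derive1_cst.
have := strip_solution_lincomb dc (fun _ _ => lexx `|c|) sw sw1.
by apply: strip_solution_eq => // y t _; ring.
Qed.

Lemma scalar_max_principle s T M a2 a1 a0 w f :
  (forall y t, s < t < T -> 0 <= a2 y t <= M) ->
  (forall y t, s < t < T -> `|a1 y t| <= M) ->
  (forall y t, s < t < T -> `|a0 y t| <= M) ->
  strip_solution s T a2 a1 w f ->
  (forall y t, s < t < T -> a0 y t * w y t <= f y t) ->
  initially_ge0 s w -> forall y t, s < t < T -> 0 <= w y t.
Proof.
move=> a2b a1b a0b sol fge wi y t st.
apply: (@cooperative_max_principle R s T M 1 (fun=> a2) (fun=> a1) (fun=> w)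
  (fun=> f) (fun _ => fun=> a0)) => //.
- by move=> k l y' t' _; rewrite !ord1.
- by move=> _ y' t' st'; rewrite big_ord1; exact: fge.
- exact: ord0.
Qed.

Lemma initially_ge0_pos s T w : s < T ->
  (forall y t, s < t < T -> 0 <= w y t) -> initially_ge0 s w.
Proof.
move=> sT w0 y e e0.
exists (setT, [set t | s < t < T]) => /= [|[y' t'] [_ /= st]].
  split; first exact: filterT.
  near=> t; apply/andP; split; near: t; first exact: nbhs_right_gt.
  exact: nbhs_right_lt.
by apply: lt_le_trans (w0 y' t' st); rewrite oppr_lt0.
Unshelve. all: by end_near. Qed.

Lemma initially_ge0_cvg s w (g : R -> R) :
  (forall y, (fun p : R * R => w p.1 p.2) @ filter_prod (nbhs y) (at_right s)
     --> g y) -> (forall y, 0 <= g y) -> initially_ge0 s w.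
Proof.
move=> wg g0 y e e0; have /cvgrPdist_lt/(_ _ e0) := wg y.
apply: filterS => -[y' t'] /=; rewrite ltr_norml => /andP[_ H].
by have := g0 y; lra.
Qed.

Lemma cvg_initial s (w : R -> R -> R) y :
  {for (y, s), continuous (fun p : R * R => w p.1 p.2)} ->
  (fun p : R * R => w p.1 p.2) @ filter_prod (nbhs y) (at_right s) --> w y s.
Proof.
move=> cw A /cw[[B C] [/= yB sC] BC]; exists (B, C) => //=; split => //.
by apply: filterS sC => z Cz _.
Qed.

End strip_solution_theory.

(** * The heat kernel *)

Section heat_kernel.
Context {R : realType}.
Variables (eps x q : R).
Hypothesis eps0 : 0 < eps.

(** Pole (x, q), mass sqrt(pi / eps): an unnormalised heat kernel of diffusivity 1 / (4 eps).
    Putting the square root into the exponent as a logarithm leaves one exponential, which is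
    positive for every [t] and differentiates by the chain rule. *)
Definition heat (y t : R) :=
  expR (- (ln (t - q) / 2) - eps * (y - x) ^+ 2 / (t - q)).

Lemma heatE y t : q < t ->
  heat y t = expR (- eps * (y - x) ^+ 2 / (t - q)) / Num.sqrt (t - q).
Proof.
move=> qt; have u0 : 0 < t - q by rewrite subr_gt0.
rewrite /heat expRD mulrC !mulNr; congr (_ * _).
rewrite expRN; congr (_^-1); apply/eqP.
rewrite -(@eqrXn2 _ 2)// ?expR_ge0// sqr_sqrtr ?(ltW u0)//.
by rewrite -expRM_natl mulrC divfK// lnK.
Qed.

Lemma heat_gt0 y t : 0 < heat y t.
Proof. exact: expR_gt0. Qed.

Lemma heat_continuous y t : q < t ->
  {for (y, t), continuous (fun p : R * R => heat p.1 p.2)}.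
Proof.
move=> qt; have u0 : 0 < t - q by rewrite subr_gt0.
have c1 : {for (y, t), continuous (fun p : R * R => p.2 - q)}.
  by apply: cvgB; [exact: cvg_snd|exact: cvg_cst].
have c2 : {for (y, t), continuous (fun p : R * R => p.1 - x)}.
  by apply: cvgB; [exact: cvg_fst|exact: cvg_cst].
have cl : {for (y, t), continuous (fun p : R * R => ln (p.2 - q))}.
  exact: (continuous_comp c1 (continuous_ln u0)).
have cV : {for (y, t), continuous (fun p : R * R => (p.2 - q)^-1)}.
  by apply: cvgV => //=; rewrite gt_eqF.
have cX : {for (y, t), continuous (fun p : R * R =>
    - (ln (p.2 - q) / 2) - eps * (p.1 - x) ^+ 2 / (p.2 - q))}.
  apply: cvgB; first by apply: cvgN; apply: cvgM; [exact: cl|exact: cvg_cst].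
  apply: cvgM; last exact: cV.
  by apply: cvgM; [exact: cvg_cst|apply: cvgM; exact: c2].
exact: (continuous_comp cX (@continuous_expR R _)).
Qed.

Let hy y t := heat y t * (- (2 * eps * (y - x)) / (t - q)).
Let hyy y t := heat y t * ((2 * eps * (y - x) / (t - q)) ^+ 2 - 2 * eps / (t - q)).
Let ht y t := heat y t * (eps * (y - x) ^+ 2 / (t - q) ^+ 2 - (t - q)^-1 / 2).

Lemma heat_derivatives (y t : R) : q < t ->
  [/\ is_derive y 1 (heat ^~ t) (hy y t), is_derive y 1 (hy ^~ t) (hyy y t)
    & is_derive t 1 (heat y) (ht y t)].
Proof.
move=> qt; have u0 : 0 < t - q by rewrite subr_gt0.
have un : t - q != 0 by rewrite gt_eqF.
have dyx : is_derive y 1 (fun v => v - x) 1.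
  apply: is_derive1_eq (is_derive1_add (is_derive_id y 1) (is_derive1_cst (- x) y)) _.
  by rewrite addr0.
have dh : is_derive y 1 (heat ^~ t) (hy y t).
  have d2 := is_derive1_scale (- (eps / (t - q))) (is_derive1_mul dyx dyx).
  have d3 := is_derive1_expR
    (is_derive1_add (is_derive1_cst (- (ln (t - q) / 2)) y) d2).
  have E : heat ^~ t = (fun z => expR (- (ln (t - q) / 2) +
      - (eps / (t - q)) * ((z - x) * (z - x)))).
    by apply/funext => z; rewrite /heat; congr expR; ring.
  rewrite E; apply: is_derive1_eq d3 _.
  rewrite -[expR _]/((fun z => expR (- (ln (t - q) / 2) +
      - (eps / (t - q)) * ((z - x) * (z - x)))) y) -E /hy.
  by ring.
split => //.
  have d2 := is_derive1_mul dh (is_derive1_scale (- (2 * eps) / (t - q)) dyx).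
  have -> : hy ^~ t = (fun z => heat z t * (- (2 * eps) / (t - q) * (z - x))).
    by apply/funext => z; rewrite /hy; ring.
  by apply: is_derive1_eq d2 _; rewrite /hyy /hy; ring.
have dtq : is_derive t 1 (fun v => v - q) 1.
  apply: is_derive1_eq (is_derive1_add (is_derive_id t 1) (is_derive1_cst (- q) t)) _.
  by rewrite addr0.
have dln : is_derive t 1 (fun v => ln (v - q)) (t - q)^-1.
  have := @is_derive1_comp R (@ln R) (fun v => v - q) t _ _ (is_derive1_ln u0) dtq.
  by rewrite mulr1.
have dV : is_derive t 1 (fun v => (v - q)^-1) (- (t - q) ^- 2).
  have := @is_deriveV R (fun v => v - q) t 1 1 un dtq.
  by move=> H; apply: is_derive1_eq H _; rewrite /GRing.scale/= mulr1.
have d3 := is_derive1_expR (is_derive1_add (is_derive1_scale (- 2^-1) dln)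
  (is_derive1_scale (- (eps * (y - x) ^+ 2)) dV)).
have E : heat y = (fun v => expR (- 2^-1 * ln (v - q) +
    - (eps * (y - x) ^+ 2) * (v - q)^-1)).
  by apply/funext => z; rewrite /heat; congr expR; ring.
rewrite E; apply: is_derive1_eq d3 _.
rewrite -[expR _]/((fun v => expR (- 2^-1 * ln (v - q) +
    - (eps * (y - x) ^+ 2) * (v - q)^-1)) t) -E /ht.
by ring.
Qed.

(** With X = eps (y - x)^2 / (t - q), each derivative is [heat] times a factor at most a constant
    times 1 + X, and (1 + X) exp(- X) <= 1. The distance [r] from the pole bounds 1 / (t - q). *)
Lemma heat_bounded (r : R) : 0 < r -> exists N : R,
  forall y t, q + r < t -> [/\ `|heat y t| <= N, `|hy y t| <= N,
    `|hyy y t| <= N & `|ht y t| <= N].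
Proof.
move=> r0; pose g0 := expR (- (ln r / 2)).
have g00 : 0 <= g0 by exact: expR_ge0.
pose rV := r^-1; have rV0 : 0 < rV by rewrite invr_gt0.
exists (g0 * (1 + 6 * eps * rV + 2 * rV)) => y t qrt.
have ru : r < t - q by rewrite ltrBrDl.
have u0 : 0 < t - q by exact: lt_trans ru.
have un : t - q != 0 by rewrite gt_eqF.
pose u := (t - q)^-1; have uu0 : 0 < u by rewrite invr_gt0.
have urV : u <= rV by rewrite lef_pV2 ?posrE// ltW.
pose X := eps * (y - x) ^+ 2 * u.
have X0 : 0 <= X by rewrite mulr_ge0 ?(ltW uu0)// mulr_ge0 ?sqr_ge0// ltW.
have hX : heat y t * (1 + X) <= g0.
  have -> : heat y t = expR (- (ln (t - q) / 2)) * expR (- X).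
    by rewrite -expRD.
  rewrite -[leRHS]mulr1 -mulrA; apply: ler_pM => //; rewrite ?expR_ge0//.
  - by rewrite mulr_ge0 ?expR_ge0// addr_ge0.
  - rewrite ler_expR lerN2 ler_pM2r// ler_ln ?posrE// ltW//.
  - by rewrite expRN ler_pdivrMl ?expR_gt0// mulr1 expR_ge1Dx.
have h0 := ltW (heat_gt0 y t).
have hXX : heat y t * X <= g0 by apply: le_trans hX; rewrite ler_wpM2l//; lra.
have h1 : heat y t <= g0.
  by apply: le_trans hX; rewrite ler_peMr//; lra.
have hb (c K : R) : 0 <= K -> `|c| <= K * (1 + X) -> `|heat y t * c| <= g0 * K.
  move=> K0 cK; rewrite normrM (ger0_norm h0).
  have := ler_wpM2l h0 cK; have := ler_wpM2l K0 hX; lra.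
have mono (K : R) : K <= 1 + 6 * eps * rV + 2 * rV ->
    g0 * K <= g0 * (1 + 6 * eps * rV + 2 * rV) by move=> ?; rewrite ler_wpM2l.
have e0 : 0 <= eps * rV by rewrite mulr_ge0 ?ltW.
have eu0 : 0 <= eps * u by rewrite mulr_ge0 ?ltW.
have eu : eps * u <= eps * rV by rewrite ler_wpM2l// ltW.
split.
- rewrite ger0_norm// (le_trans h1)// ler_peMr//; lra.
- apply: le_trans (mono (1 + eps * rV) _); last by lra.
  apply: hb; first lra.
  rewrite ler_norml -/u.
  have A : 0 <= eps * u * (1 + (y - x)) ^+ 2 by rewrite mulr_ge0// sqr_ge0.
  have B : 0 <= eps * u * (1 - (y - x)) ^+ 2 by rewrite mulr_ge0// sqr_ge0.
  have C : 0 <= eps * rV * X by rewrite mulr_ge0.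
  rewrite /X in C A B X0 *; apply/andP; split; lra.
- apply: le_trans (mono (6 * eps * rV) _); last by lra.
  apply: hb; first by lra.
  have -> : (2 * eps * (y - x) / (t - q)) ^+ 2 - 2 * eps / (t - q) =
      4 * (eps * u) * X - 2 * (eps * u) by rewrite /X /u; ring.
  have : eps * u * X <= eps * rV * X by rewrite ler_wpM2r.
  have : 0 <= eps * u * X by rewrite mulr_ge0.
  by rewrite ler_norml => ? ?; apply/andP; split; lra.
- apply: le_trans (mono (2 * rV) _); last by lra.
  apply: hb; first by lra.
  have -> : eps * (y - x) ^+ 2 / (t - q) ^+ 2 - (t - q)^-1 / 2 = u * X - u / 2.
    by rewrite /X /u; field.
  have : u * X <= rV * X by rewrite ler_wpM2r.
  have : 0 <= u * X by rewrite mulr_ge0// ltW.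
  by rewrite ler_norml => ? ?; apply/andP; split; lra.
Qed.

(** The source is simply the residual of the kernel in the given equation. It is bounded because the
    pole lies strictly before [s]. *)
Lemma heat_strip_solution s T M (a2 a1 : R -> R -> R) : q < s -> 0 <= M ->
  (forall y t, s < t < T -> `|a2 y t| <= M) ->
  (forall y t, s < t < T -> `|a1 y t| <= M) ->
  exists f, strip_solution s T a2 a1 heat f /\
    exists K, forall y t, s < t < T -> `|f y t| <= K.
Proof.
move=> qs M0 a2M a1M; have [|N HN] := @heat_bounded (s - q); first lra.
have HN' y t : s < t < T -> [/\ `|heat y t| <= N, `|hy y t| <= N,
    `|hyy y t| <= N & `|ht y t| <= N].
  by move=> /andP[st _]; apply: HN; rewrite addrC subrK.
have qt t : s < t < T -> q < t by move=> /andP[st _]; exact: lt_trans st.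
exists (fun y t => ht y t - a2 y t * hyy y t - a1 y t * hy y t); split; first split.
- by exists N => y t /(HN' y)[].
- by move=> y t /qt; exact: heat_continuous.
- exists hy, hyy, ht => y t /qt /(heat_derivatives y)[? ? ?]; split => //.
  by ring.
- exists (N + M * N + M * N) => y t st; have [_ n1 n2 n3] := HN' y t st.
  rewrite (le_trans (ler_normB _ _))// lerD// ?(le_trans (ler_normB _ _))//.
    by rewrite lerD// normrM; apply: ler_pM => //; exact: a2M.
  by rewrite normrM; apply: ler_pM => //; exact: a1M.
Qed.

End heat_kernel.

(** * Duhamel's principle for subsolutions *)

Section duhamel.
Context {R : realType}.

Lemma initially_ge0_linear (s T L : R) (w : R -> R -> R) : s < T -> 0 <= L ->
  (forall y t, s < t < T -> - (L * (t - s)) <= w y t) -> initially_ge0 s w.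
Proof.
move=> sT L0 wL y e e0.
have e1 : 0 < e / (L + 1) by rewrite divr_gt0//; lra.
exists (setT, [set t | s < t < T /\ t - s < e / (L + 1)]) => /=.
  split; first exact: filterT.
  near=> t; split; last by near: t; exact: nbhs_right_ltDr.
  apply/andP; split; near: t; first exact: nbhs_right_gt.
  exact: nbhs_right_lt.
move=> [y' t'] [_ /= [st te]]; apply: lt_le_trans (wL y' t' st).
rewrite ltrN2; move: te; rewrite ltr_pdivlMr; last lra.
by case/andP: st => st _; lra.
Unshelve. all: by end_near. Qed.

Lemma initially_ge0_add (s : R) (w w' : R -> R -> R) :
  initially_ge0 s w -> initially_ge0 s w' ->
  initially_ge0 s (fun y t => w y t + w' y t).
Proof.
move=> iw iw' y e e0; have e2 : 0 < e / 2 by lra.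
by apply: filterS2 (iw y _ e2) (iw' y _ e2) => -[a b] /=; lra.
Qed.

Lemma initially_ge0_ext (s T : R) (w w' : R -> R -> R) : s < T ->
  (forall y t, s < t < T -> w y t = w' y t) ->
  initially_ge0 s w -> initially_ge0 s w'.
Proof.
move=> sT ww iw y e e0.
have : \forall p \near filter_prod (nbhs y) (at_right s), s < p.2 < T.
  exists (setT, [set t | s < t < T]) => /=; last by move=> [? ?] [].
  split; first exact: filterT.
  near=> t; apply/andP; split; near: t; first exact: nbhs_right_gt.
  exact: nbhs_right_lt.
by apply: filterS2 (iw y _ e0) => -[a b] /= ? ?; rewrite -ww.
Unshelve. all: by end_near. Qed.

(** For c >= 0 and |a0| <= M this is a supersolution of the homogeneous equation, so it carries
    accumulated errors forward in time. *)
Lemma strip_solution_exp (s T M c : R) (a2 a1 : R -> R -> R) :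
  strip_solution s T a2 a1 (fun _ t => c * expR (M * (t - s)))
    (fun _ t => c * (M * expR (M * (t - s)))).
Proof.
apply: (@strip_solution_time R s T a2 a1 (fun t => c * expR (M * (t - s))) _
  (`|c| * expR (`|M| * (T - s)))) => t st.
  have d := is_derive1_scale M (is_derive1_add (is_derive_id t 1)
    (is_derive1_cst (- s) t)).
  by apply: is_derive1_eq (is_derive1_scale c (is_derive1_expR d)) _; ring.
rewrite normrM ler_wpM2l// (ger0_norm (expR_ge0 _)) ler_expR.
case/andP: st => st tT.
apply: (@le_trans _ _ (`|M| * (t - s))).
  by rewrite ler_wpM2r ?ler_norm//; lra.
by rewrite ler_wpM2l//; lra.
Qed.

Variables (s T M : R) (a2 a1 a0 : R -> R -> R).
Hypothesis M0 : 0 <= M.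
Hypothesis a2_bnd : forall y t, s < t < T -> 0 <= a2 y t <= M.
Hypothesis a1_bnd : forall y t, s < t < T -> `|a1 y t| <= M.
Hypothesis a0_bnd : forall y t, s < t < T -> `|a0 y t| <= M.

Let sub sg t : s <= sg -> sg < t < T -> s < t < T.
Proof. by move=> ssg /andP[sgt ->]; rewrite (le_lt_trans ssg). Qed.

Let max_principle sg w f : s <= sg -> strip_solution sg T a2 a1 w f ->
  (forall y t, sg < t < T -> a0 y t * w y t <= f y t) ->
  initially_ge0 sg w -> forall y t, sg < t < T -> 0 <= w y t.
Proof.
move=> ssg; apply: (scalar_max_principle (M := M)) => y t /(sub ssg).
- exact: a2_bnd.
- exact: a1_bnd.
- exact: a0_bnd.
Qed.

(** Adding K (t - sg) exp(M (t - sg)) to [gam] makes it a supersolution: the derivative of the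
    linear factor pays for the residual [K], that of the exponential for the zero-order term. *)
Lemma evolution_le (sg K : R) (gam fg psi : R -> R -> R) : s <= sg -> 0 <= K ->
  strip_solution s T a2 a1 gam fg ->
  (forall y t, s < t < T -> a0 y t * gam y t - K <= fg y t) ->
  strip_solution sg T a2 a1 psi (fun y t => a0 y t * psi y t) ->
  initially_ge0 sg (fun y t => gam y t - psi y t) ->
  forall y t, sg < t < T ->
    psi y t <= gam y t + K * expR (M * (T - s)) * (t - sg).
Proof.
move=> ssg K0 sgam fgK spsi ipsi y t st.
pose p u := K * ((u - sg) * expR (M * (u - sg))).
pose p' u := K * (expR (M * (u - sg)) + (u - sg) * (M * expR (M * (u - sg)))).
have dp (u : R) : sg < u < T -> is_derive u 1 p (p' u).
  move=> _; have d1 := is_derive1_add (is_derive_id u 1) (is_derive1_cst (- sg) u).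
  apply: is_derive1_eq (is_derive1_scale K (is_derive1_mul d1
    (is_derive1_expR (is_derive1_scale M d1)))) _.
  by rewrite /p'; ring.
have p0 u : sg < u < T -> 0 <= p u.
  by move=> /andP[su _]; rewrite !mulr_ge0 ?expR_ge0// subr_ge0 ltW.
have pN u : sg < u < T -> `|p u| <= K * expR (M * (T - s)) * (T - sg).
  move=> su; rewrite ger0_norm ?p0// /p -mulrA ler_wpM2l// mulrC.
  case/andP: su => su uT; apply: ler_pM; rewrite ?expR_ge0//; try lra.
  by rewrite ler_expR ler_wpM2l//; lra.
have sp := strip_solution_time a2 a1 dp pN.
have := strip_solution_scale_add (-1) spsi
  (strip_solution_scale_add 1 sp (strip_solution_sub ssg sgam)).
move=> sw; have sT : sg < T by case/andP: st; exact: lt_trans.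
unshelve (epose proof (@max_principle _ _ _ ssg sw _ _ y t st) as H).
- move=> y' t' st'; have := fgK y' t' (sub ssg st').
  have := a0_bnd y' (sub ssg st'); rewrite ler_norml => /andP[b1 b2].
  case/andP: st' => st' _.
  have e1 : 1 <= expR (M * (t' - sg)).
    by rewrite -expR0 ler_expR mulr_ge0//; lra.
  have A : 0 <= K * (t' - sg) * expR (M * (t' - sg)) * (M - a0 y' t').
    by rewrite !mulr_ge0 ?expR_ge0//; lra.
  have B : 0 <= K * (expR (M * (t' - sg)) - 1) by rewrite mulr_ge0//; lra.
  rewrite /p /p'; lra.
- have ip : initially_ge0 sg (fun=> p).
    by apply: (initially_ge0_pos sT) => y' t'; exact: p0.
  apply: (initially_ge0_ext sT _ (initially_ge0_add ipsi ip)) => y' t' _.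
  by ring.
have : p t <= K * expR (M * (T - s)) * (t - sg).
  rewrite /p -mulrA ler_wpM2l// mulrC; case/andP: st => st tT.
  by rewrite ler_wpM2r ?ler_expR ?ler_wpM2l//; lra.
by move: H; lra.
Qed.

(** During a step, (t - sg) F psi has the extra source F psi, which exceeds F gam by at most F K (t
    - sg); a quadratic corrector absorbs this excess. After the step the coefficient is frozen at h
    F, and the homogeneous evolution carries the gain to later times. *)
Lemma duhamel_step (sg h F K : R) (W fW psi gam : R -> R -> R) :
  s <= sg -> 0 < h -> 0 <= F -> 0 <= K ->
  strip_solution sg T a2 a1 W fW ->
  (forall y t, sg < t < T -> a0 y t * W y t + F * gam y t <= fW y t) ->
  (forall y t, sg < t < T -> 0 <= gam y t) ->
  initially_ge0 sg W ->
  strip_solution sg T a2 a1 psi (fun y t => a0 y t * psi y t) ->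
  (forall y t, sg < t < T -> 0 <= psi y t <= gam y t + K * (t - sg)) ->
  forall y t, sg + h < t < T ->
    h * F * psi y t - 2 * (F * K) * h ^+ 2 * expR (M * (t - s)) <= W y t.
Proof.
move=> ssg h0 F0 K0 sW fW_ge gam0 iW spsi psi_bnd y t st.
have [[N HN] _ _] := spsi.
have sgT : sg < T by case/andP: st; lra.
pose C := F * K; have C0 : 0 <= C by exact: mulr_ge0.
have stage1 y' t' : sg < t' < T ->
    (t' - sg) * F * psi y' t' - C * (t' - sg) ^+ 2 * expR (M * (t' - s)) <= W y' t'.
  move=> st'.
  pose p u := C * ((u - sg) * (u - sg) * expR (M * (u - s))).
  pose p' u := C * (2 * (u - sg) * expR (M * (u - s)) +
    (u - sg) * (u - sg) * (M * expR (M * (u - s)))).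
  have dp (u : R) : sg < u < T -> is_derive u 1 p (p' u).
    move=> _; have d1 := is_derive1_add (is_derive_id u 1) (is_derive1_cst (- sg) u).
    have d2 := is_derive1_add (is_derive_id u 1) (is_derive1_cst (- s) u).
    apply: is_derive1_eq (is_derive1_scale C (is_derive1_mul
      (is_derive1_mul d1 d1) (is_derive1_expR (is_derive1_scale M d2)))) _.
    by rewrite /p'; ring.
  have p0 u : sg < u < T -> 0 <= p u.
    by move=> /andP[su _]; rewrite !mulr_ge0 ?expR_ge0// subr_ge0 ltW.
  have pN u : sg < u < T ->
      `|p u| <= C * ((T - sg) * (T - sg) * expR (M * (T - s))).
    move=> su; rewrite ger0_norm ?p0// /p ler_wpM2l//.
    case/andP: su => su uT; apply: ler_pM; rewrite ?expR_ge0 ?mulr_ge0//; try lra.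
      by apply: ler_pM; lra.
    by rewrite ler_expR ler_wpM2l//; lra.
  have sp := strip_solution_time a2 a1 dp pN.
  have dq (u : R) : sg < u < T -> is_derive u 1 (fun v => - F * (v - sg)) (- F).
    move=> _; have d1 := is_derive1_add (is_derive_id u 1) (is_derive1_cst (- sg) u).
    by apply: is_derive1_eq (is_derive1_scale (- F) d1) _; ring.
  have qN u : sg < u < T -> `|- F * (u - sg)| <= F * (T - sg).
    move=> /andP[su uT]; rewrite normrM normrN (ger0_norm F0) ler_wpM2l//.
    by rewrite ger0_norm; lra.
  have sw := strip_solution_scale_add 1 sp (strip_solution_lincomb dq qN spsi sW).
  unshelve (epose proof (@max_principle _ _ _ ssg sw _ _ y' t' st') as H).
  - move=> v u svu; have := fW_ge v u svu; have /andP[q0 q1] := psi_bnd v u svu.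
    have := a0_bnd v (sub ssg svu); rewrite ler_norml => /andP[b1 b2].
    have /andP[su _] := svu.
    have e1 : 1 <= expR (M * (u - s)).
      by rewrite -expR0 ler_expR mulr_ge0//; lra.
    have A : 0 <= C * (u - sg) * (expR (M * (u - s)) - 1).
      by rewrite !mulr_ge0//; lra.
    have B : 0 <= C * ((u - sg) * (u - sg)) * expR (M * (u - s)) * (M - a0 v u).
      by rewrite !mulr_ge0 ?expR_ge0//; lra.
    have D : 0 <= F * (gam v u + K * (u - sg) - psi v u).
      by rewrite mulr_ge0//; lra.
    have G : 0 <= C * (u - sg) by rewrite mulr_ge0//; lra.
    rewrite /C in A B G *; rewrite /p /p' /C; lra.
  - have i1 : initially_ge0 sg (fun v u => - F * (u - sg) * psi v u + p u).
      apply: (@initially_ge0_linear sg T (F * `|N|)) => //; first exact: mulr_ge0.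
      move=> v u svu; have pu0 := p0 u svu.
      have /andP[su _] := svu.
      have : psi v u <= `|N|.
        by rewrite (le_trans (ler_norm _))// (le_trans (HN v u svu))// ler_norm.
      move=> psiN; have : 0 <= F * (u - sg) * (`|N| - psi v u).
        by rewrite !mulr_ge0//; lra.
      lra.
    apply: (initially_ge0_ext sgT _ (initially_ge0_add i1 iW)) => v u _.
    by ring.
  by move: H; rewrite /p; lra.
have ssgh : s <= sg + h by lra.
have shT : sg + h < T by case/andP: st; lra.
pose D := 2 * C * h ^+ 2.
have D0 : 0 <= D by apply: mulr_ge0 (sqr_ge0 h); apply: mulr_ge0 C0.
have subh (u : R) : sg + h < u < T -> sg < u < T by move=> /andP[? ?]; lra.
have sgsh : sg <= sg + h by lra.
(* The prefactor moves the base point of the barrier from [sg + h] to [s], so that the errors of all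
   steps share one exponential. *)
have sw := strip_solution_scale_add (expR (M * (sg + h - s)))
  (strip_solution_exp (sg + h) T M D a2 a1)
  (strip_solution_scale_add (- (h * F)) (strip_solution_sub sgsh spsi)
    (strip_solution_sub sgsh sW)).
have Eexp u : expR (M * (sg + h - s)) * (D * expR (M * (u - (sg + h)))) =
    D * expR (M * (u - s)).
  by rewrite mulrCA -expRD; congr (_ * expR _); ring.
unshelve (epose proof (@max_principle _ _ _ ssgh sw _ _ y t st) as H).
- move=> v u svu; have svu' := subh u svu; have := fW_ge v u svu'.
  have := a0_bnd v (sub ssg svu'); rewrite ler_norml => /andP[b1 b2].
  have : 0 <= F * gam v u by rewrite mulr_ge0// gam0.
  have : 0 <= D * expR (M * (u - s)) * (M - a0 v u).
    by rewrite !mulr_ge0 ?expR_ge0//; lra.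
  rewrite Eexp; have := Eexp u; move=> E.
  have -> : expR (M * (sg + h - s)) * (D * (M * expR (M * (u - (sg + h))))) =
    M * (D * expR (M * (u - s))) by rewrite -E; ring.
  lra.
(* The comparison restarts just after [sg + h], where the first stage gives an error with (u - sg)^2
   in place of h^2. Since (7 / 5)^2 < 2, the factor 2 of the statement covers it for u - sg < 7 h /
   5. *)
- move=> v e e0.
  exists (setT, [set u | sg + h < u < T /\ u - (sg + h) < h * (2 / 5)]) => /=.
    split; first exact: filterT.
    near=> u; split; last first.
      by near: u; apply: nbhs_right_ltDr; rewrite mulr_gt0.
    apply/andP; split; near: u; first exact: nbhs_right_gt.
    exact: nbhs_right_lt.
  move=> [v' u] [_ /= [svu uh]].
  have svu' := subh u svu; have := stage1 v' u svu'.
  have /andP[su uT] := svu.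
  have /andP[q0 _] := psi_bnd v' u svu'.
  rewrite Eexp => H.
  have A : 0 <= (u - (sg + h)) * F * psi v' u by rewrite !mulr_ge0//; lra.
  have sq : (u - sg) ^+ 2 <= 2 * h ^+ 2.
    have : (u - sg) ^+ 2 <= (h * (7 / 5)) ^+ 2.
      by rewrite ler_pXn2r ?nnegrE//; lra.
    have : 0 <= h ^+ 2 by exact: sqr_ge0.
    rewrite exprMn; lra.
  have B : 0 <= C * (2 * h ^+ 2 - (u - sg) ^+ 2) * expR (M * (u - s)).
    by rewrite !mulr_ge0 ?expR_ge0// subr_ge0.
  rewrite /D; lra.
by move: H; rewrite Eexp /D /C; lra.
Unshelve. all: by end_near. Qed.

End duhamel.

(** * Riemann sums and the limit of vanishing time steps *)

Section duhamel_limit.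
Context {R : realType}.

Lemma expr_sub_le (a b : R) p : 0 <= b <= a ->
  a ^+ p.+1 - b ^+ p.+1 <= p.+1%:R * a ^+ p * (a - b).
Proof.
move=> /andP[b0 ba]; have a0 : 0 <= a by exact: le_trans ba.
elim: p => [|p IH]; first by rewrite !expr1 expr0 !mul1r.
have A : 0 <= (a ^+ p.+1 - b ^+ p.+1) * (a - b).
  by rewrite mulr_ge0 ?subr_ge0// lerXn2r.
have B := ler_wpM2l a0 IH.
have C : 0 <= a ^+ p by exact: exprn_ge0.
rewrite -natr1 !exprS in A B *; lra.
Qed.

(** Upper Riemann sum of x^p on [0, n]: each cell contributes at least the increment of x^(p+1) / (p
    + 1). *)
Lemma sum_powers_ge (n p : nat) :
  (n%:R : R) ^+ p.+1 <= p.+1%:R * \sum_(l < n.+1) l%:R ^+ p.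
Proof.
elim: n => [|n IH]; first by rewrite expr0n/= mulr_ge0// sumr_ge0.
rewrite big_ord_recr /= mulrDr -lerBlDr; apply: le_trans IH.
have n0 := ler0n R n.
have H : 0 <= (n%:R : R) <= n.+1%:R by rewrite -natr1; lra.
have := expr_sub_le p H.
by rewrite -[n.+1%:R]natr1 (addrC n%:R) addrK mulr1 => ?; lra.
Qed.

Lemma bernoulli_sub (u : R) k : 0 <= u <= 1 -> 1 - k%:R * u <= (1 - u) ^+ k.
Proof.
move=> /andP[u0 u1]; elim: k => [|k IH]; first by rewrite mul0r subr0 expr0.
have A := ler_wpM2l (_ : 0 <= 1 - u) IH.
have : 0 <= k%:R * (u * u) by rewrite !mulr_ge0.
by rewrite exprS -natr1 => ?; move: A; rewrite subr_ge0 => /(_ u1); lra.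
Qed.

(** The mesh has [n.+2] cells but only [n.+1] nodes, because the last step must end strictly before
    the time of evaluation. The sum dominates the integral up to n h = X (1 - 2 / (n + 2)), and
    Bernoulli's inequality prices the two lost cells. *)
Lemma riemann_power_ge (X : R) (n p : nat) : 0 <= X ->
  X ^+ p.+1 / p.+1%:R - 2 * X ^+ p.+1 / n.+2%:R <=
  X / n.+2%:R * \sum_(l < n.+1) (l%:R * (X / n.+2%:R)) ^+ p.
Proof.
move=> X0; have n2 : 0 < (n.+2%:R : R) by [].
have p1 : 0 < (p.+1%:R : R) by [].
set h := X / n.+2%:R; have h0 : 0 <= h by rewrite divr_ge0.
have -> : h * \sum_(l < n.+1) (l%:R * h) ^+ p =
    h ^+ p.+1 * \sum_(l < n.+1) l%:R ^+ p.
  rewrite exprS -mulrA; congr (_ * _); rewrite mulr_sumr.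
  by apply: eq_bigr => l _; rewrite exprMn mulrC.
have S := ler_wpM2l (exprn_ge0 p.+1 h0) (sum_powers_ge n p).
have u01 : 0 <= 2 / (n.+2%:R : R) <= 1.
  rewrite divr_ge0//= ler_pdivrMr// mul1r; exact: (ler_nat R 2 n.+2).
have B := ler_wpM2l (exprn_ge0 p.+1 X0) (bernoulli_sub p.+1 u01).
have E : h ^+ p.+1 * n%:R ^+ p.+1 = X ^+ p.+1 * (1 - 2 / n.+2%:R) ^+ p.+1.
  rewrite -!exprMn; congr (_ ^+ _); rewrite /h.
  have -> : (n%:R : R) = n.+2%:R - 2 by rewrite -!natr1; ring.
  by field; rewrite gt_eqF.
have : X ^+ p.+1 * (1 - p.+1%:R * (2 / n.+2%:R)) <=
    p.+1%:R * (h ^+ p.+1 * \sum_(l < n.+1) l%:R ^+ p).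
  by apply: le_trans B _; rewrite -E; apply: le_trans S _; rewrite mulrCA.
move=> H; rewrite -(ler_pM2l p1); apply: le_trans H.
rewrite le_eqVlt; apply/orP; left; apply/eqP.
by move: n2 p1; set a := n.+2%:R; set b := p.+1%:R => a0 b0; field; rewrite !gt_eqF.
Qed.

Lemma le_of_le_add_inv (a b C : R) :
  (forall n : nat, a <= b + C / n.+1%:R) -> a <= b.
Proof.
move=> H; rewrite leNgt; apply/negP => ab.
have ab0 : 0 < a - b by rewrite subr_gt0.
pose n := Num.truncn (`|C| / (a - b)).
have Cn : `|C| < n.+1%:R * (a - b).
  by rewrite -ltr_pdivrMr//; exact: truncnS_gt.
have := H n; rewrite -lerBlDl ler_pdivlMr// => K.
have := ler_norm C; rewrite mulrC in Cn; lra.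
Qed.

Variables (s T M : R) (a2 a1 a0 : R -> R -> R).
Hypothesis M0 : 0 <= M.
Hypothesis a2_bnd : forall y t, s < t < T -> 0 <= a2 y t <= M.
Hypothesis a1_bnd : forall y t, s < t < T -> `|a1 y t| <= M.
Hypothesis a0_bnd : forall y t, s < t < T -> `|a0 y t| <= M.
Variables (K c : R) (W fW gam : R -> R -> R) (psi : R -> R -> R -> R).
Hypothesis K0 : 0 <= K.
Hypothesis sW : strip_solution s T a2 a1 W fW.
Hypothesis iW : initially_ge0 s W.
Hypothesis gam0 : forall y t, s < t < T -> 0 <= gam y t.
Hypothesis spsi : forall sg, s <= sg < T ->
  strip_solution sg T a2 a1 (psi sg) (fun y t => a0 y t * psi sg y t).
Hypothesis psi_bnd : forall sg, s <= sg < T -> forall y t, sg < t < T ->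
  0 <= psi sg y t <= gam y t + K * (t - sg).

(** Subtracting the gain of a step, a multiple of a homogeneous solution, and adding its error
    barrier leave a remainder that still has source at least F gam and starts nonnegative at the
    next node. Monotonicity of [F] replaces the source on a step by its value at the left node. *)
Lemma duhamel_sum (F : R -> R) (Fmax h : R) (n : nat) : 0 < h ->
  (forall t, s <= t < T -> 0 <= F t <= Fmax) ->
  (forall t t', s <= t -> t <= t' -> t' < T -> F t <= F t') ->
  (forall y t, s < t < T -> a0 y t * W y t + F t * gam y t <= fW y t) ->
  forall y t, s + n%:R * h < t < T ->
    h * \sum_(l < n) F (s + l%:R * h) * psi (s + l%:R * h) y t
      - n%:R * (2 * (Fmax * K) * h ^+ 2) * expR (M * (t - s)) <= W y t.
Proof.
move=> h0 F_bnd F_mono fW_ge.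
pose C := 2 * (Fmax * K) * h ^+ 2.
pose sg m := s + m%:R * h.
have ssg m : s <= sg m by rewrite lerDl mulr_ge0// ltW.
pose Wm m y t := W y t - h * (\sum_(l < m) F (sg l) * psi (sg l) y t)
  + m%:R * C * expR (M * (t - s)).
have subm m t : sg m < t < T -> s < t < T.
  by move=> /andP[H ->]; rewrite (le_lt_trans (ssg m)).
have claim m : sg m < T -> exists g,
    [/\ strip_solution (sg m) T a2 a1 (Wm m) g,
        forall y t, sg m < t < T -> a0 y t * Wm m y t + F t * gam y t <= g y t
      & initially_ge0 (sg m) (Wm m)].
  elim: m => [|m IH] mT.
    have Wm0 : Wm 0%N = W.
      by apply/funext => y; apply/funext => t; rewrite /Wm big_ord0; ring.
    have sg0 : sg 0%N = s by rewrite /sg mul0r addr0.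
    by exists fW; rewrite Wm0 sg0.
  have sgS : sg m.+1 = sg m + h by rewrite /sg -natr1; ring.
  have mT' : sg m < T by move: mT; rewrite sgS; lra.
  have [g [sm gm im]] := IH mT'.
  have msT : s <= sg m < T by rewrite ssg.
  have /andP[F0 FM] := F_bnd _ msT.
  have submm t : sg m.+1 < t < T -> sg m < t < T.
    by rewrite sgS => /andP[? ->]; rewrite andbT; lra.
  have WmS y t : Wm m.+1 y t =
      Wm m y t - h * F (sg m) * psi (sg m) y t + C * expR (M * (t - s)).
    by rewrite /Wm big_ord_recr/= -natr1; ring.
  have sgle : sg m <= sg m.+1 by rewrite sgS; lra.
  have C0 : 0 <= C.
    apply: mulr_ge0 (sqr_ge0 h); rewrite mulr_ge0// mulr_ge0//.
    exact: le_trans FM.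
  exists (fun y t => g y t - h * F (sg m) * (a0 y t * psi (sg m) y t)
    + C * (M * expR (M * (t - s)))); split.
  - have s1 := strip_solution_sub (ssg m.+1) (strip_solution_exp s T M C a2 a1).
    have s2 := strip_solution_scale_add (- (h * F (sg m)))
      (strip_solution_sub sgle (spsi msT)) (strip_solution_sub sgle sm).
    apply: strip_solution_eq (strip_solution_scale_add 1 s1 s2) => y t.
      by rewrite WmS; ring.
    by move=> _; ring.
  - move=> y t st; have := gm y t (submm t st).
    have := a0_bnd y (subm _ _ st); rewrite ler_norml => /andP[b1 b2].
    have : 0 <= C * expR (M * (t - s)) * (M - a0 y t).
      by rewrite !mulr_ge0 ?expR_ge0//; lra.
    rewrite WmS; lra.
  - apply: (initially_ge0_pos mT) => y t st.
    rewrite WmS; have st' := submm t st.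
    have := @duhamel_step R s T M a2 a1 a0 M0 a2_bnd a1_bnd a0_bnd (sg m) h
      (F (sg m)) K (Wm m) g (psi (sg m)) gam (ssg m) h0 F0 K0 sm.
    move=> /(_ _ _ im (spsi msT) (psi_bnd msT) y t).
    rewrite -sgS => H.
    have {}H := H _ _ st.
    have : h * F (sg m) * psi (sg m) y t -
        2 * (F (sg m) * K) * h ^+ 2 * expR (M * (t - s)) <= Wm m y t.
      apply: H => y' t' st1.
        apply: le_trans (gm y' t' st1); rewrite lerD2l ler_wpM2r//.
          by apply: gam0; exact: subm st1.
        by case/andP: st1 => st1 tT; apply: F_mono => //; exact: ltW.
      by apply: gam0; exact: subm st1.
    have : 0 <= 2 * ((Fmax - F (sg m)) * K) * h ^+ 2 * expR (M * (t - s)).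
      apply: mulr_ge0 (expR_ge0 _); apply: mulr_ge0 (sqr_ge0 h).
      by rewrite mulr_ge0// mulr_ge0// subr_ge0.
    rewrite /C; lra.
move=> y t st.
have nT : sg n < T by case/andP: st; exact: lt_trans.
have [g [sn gn in_]] := claim n nT.
have : 0 <= Wm n y t.
  apply: (@scalar_max_principle R (sg n) T M a2 a1 a0 (Wm n) g) => // y' t' st'.
  - by apply: a2_bnd; exact: subm st'.
  - by apply: a1_bnd; exact: subm st'.
  - by apply: a0_bnd; exact: subm st'.
  - apply: le_trans (gn y' t' st'); rewrite lerDl.
    have /andP[s1 t1] := subm _ _ st'.
    have /F_bnd/andP[Ft _] : s <= t' < T by rewrite (ltW s1).
    by rewrite mulr_ge0//; apply: gam0; exact: subm st'.
rewrite /Wm -/C -/(sg _); lra.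
Qed.

Hypothesis c0 : 0 <= c.
Hypothesis psi_ge : forall sg, s <= sg < T -> forall y t, sg < t < T ->
  c * gam y t <= psi sg y t.

(** Each restarted solution is bounded below by c gam at the fixed point (y, t), so the sum becomes
    c gam times a Riemann sum of the polynomial source, which integrates term by term. Nonnegative
    coefficients make that source monotone. *)
Lemma duhamel_lower_bound (N : nat) (f : nat -> R) :
  (forall p, 0 <= f p) ->
  (forall y t, s < t < T ->
    a0 y t * W y t + (\sum_(p < N) f p * (t - s) ^+ p) * gam y t <= fW y t) ->
  forall y t, s < t < T ->
    c * gam y t * \sum_(p < N) f p * ((t - s) ^+ p.+1 / p.+1%:R) <= W y t.
Proof.
move=> f0 fW_ge y t st; have /andP[s_t tT] := st.
pose F u := \sum_(p < N) f p * (u - s) ^+ p.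
have F_mono u u' : s <= u -> u <= u' -> F u <= F u'.
  move=> su uu'; apply: ler_sum => p _; rewrite ler_wpM2l// lerXn2r// ?nnegrE; lra.
have F0 u : s <= u -> 0 <= F u.
  by move=> su; apply: sumr_ge0 => p _; rewrite mulr_ge0// exprn_ge0// subr_ge0.
set X := t - s; have X0 : 0 < X by rewrite subr_gt0.
have g0 := gam0 y st.
have cg0 : 0 <= c * gam y t by exact: mulr_ge0.
pose S := \sum_(p < N) f p * X ^+ p.+1.
have S0 : 0 <= S by apply: sumr_ge0 => p _; rewrite mulr_ge0// exprn_ge0// ltW.
(* [n.+1] errors of order h^2 with h = X / (n + 2) add up to at most [ER / n.+2]. *)
pose ER := 2 * (F T * K) * X ^+ 2 * expR (M * X).
have FT0 : 0 <= F T by apply: F0; lra.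
have ER0 : 0 <= ER.
  apply: mulr_ge0 (expR_ge0 _); apply: mulr_ge0 (sqr_ge0 X).
  by rewrite mulr_ge0// mulr_ge0.
apply: (@le_of_le_add_inv _ _ (2 * (2 * (c * gam y t) * S + ER))) => n.
have n2 : 0 < (n.+2%:R : R) by [].
pose h := X / n.+2%:R; have h0 : 0 < h by rewrite divr_gt0.
have nh : n.+2%:R * h = X by rewrite /h mulrC divfK// gt_eqF.
have lt_t l : (l <= n.+1)%N -> s + l%:R * h < t.
  move=> ln; rewrite -ltrBrDl -/X -nh ltr_pM2r// ltr_nat//.
have Fb u : s <= u < T -> 0 <= F u <= F T.
  by move=> /andP[su uT]; rewrite F0//= F_mono// ltW.
have st1 : s + n.+1%:R * h < t < T by rewrite lt_t.
have := duhamel_sum h0 Fb (fun u u' su uu' _ => F_mono u u' su uu') fW_ge y st1.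
have lowS : c * gam y t * (h * \sum_(l < n.+1) F (s + l%:R * h)) <=
    h * \sum_(l < n.+1) F (s + l%:R * h) * psi (s + l%:R * h) y t.
  rewrite mulrCA ler_pM2l// mulr_sumr; apply: ler_sum => l _.
  have sl : s <= s + l%:R * h by rewrite lerDl mulr_ge0// ltW.
  have lt : s + l%:R * h < t by apply: lt_t; exact: ltnW.
  rewrite mulrC ler_wpM2l ?F0// psi_ge//; last by rewrite lt.
  by rewrite sl (lt_trans lt).
have lowF : \sum_(p < N) f p * (X ^+ p.+1 / p.+1%:R) - 2 * S / n.+2%:R <=
    h * \sum_(l < n.+1) F (s + l%:R * h).
  have -> : h * \sum_(l < n.+1) F (s + l%:R * h) =
      \sum_(p < N) f p * (h * \sum_(l < n.+1) (l%:R * h) ^+ p).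
    under eq_bigr do rewrite /F addrC addKr.
    rewrite exchange_big/= mulr_sumr; apply: eq_bigr => p _.
    by rewrite -mulr_sumr mulrCA.
  have -> : 2 * S / n.+2%:R = \sum_(p < N) f p * (2 * X ^+ p.+1 / n.+2%:R).
    by rewrite /S mulr_sumr mulr_suml; apply: eq_bigr => p _; ring.
  rewrite -sumrB; apply: ler_sum => p _; rewrite -mulrBr ler_wpM2l//.
  by apply: riemann_power_ge; exact: ltW.
have := ler_wpM2l cg0 lowF.
have E1 : n.+1%:R * (2 * (F T * K) * h ^+ 2) * expR (M * (t - s)) <= ER / n.+2%:R.
  have -> : n.+1%:R * (2 * (F T * K) * h ^+ 2) * expR (M * (t - s)) =
      (n.+1%:R / n.+2%:R) * (ER / n.+2%:R).
    by rewrite /ER /h; field.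
  rewrite ler_piMl ?divr_ge0// ler_pdivrMr// mul1r ler_nat//.
have E2 : (2 * (c * gam y t) * S + ER) / n.+2%:R <=
    2 * (2 * (c * gam y t) * S + ER) / n.+1%:R.
  have A0 : 0 <= 2 * (c * gam y t) * S + ER.
    by rewrite addr_ge0// mulr_ge0// mulr_ge0.
  apply: ler_pM; rewrite ?invr_ge0//; first lra.
  by rewrite lef_pV2 ?posrE// ler_nat.
move: E1 E2 lowS; rewrite -/X; set A := \sum_(p < N) _; set B := h * \sum_(l < n.+1) F _.
move=> E1 E2 lowS H1 H2.
move: E1 E2 lowS H1 H2; set U := _ * expR _.
set V := h * (\sum_(l < n.+1) _); set G := c * gam y t.
set i2 := n.+2%:R^-1; set i1 := n.+1%:R^-1.
clearbody U V G i2 i1 A B; lra.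
Qed.

End duhamel_limit.

(** * Evolution operators of a fundamental solution *)

Section fundamental_solution_theory.
Context {R : realType}.
Notation mu := (@lebesgue_measure R).

Lemma diag_mulmx_entry (d : nat) (A X : 'M[R]_d) i j :
  is_diag_mx A -> (A *m X) i j = A i i * X i j.
Proof.
move=> /is_diag_mxP dA; rewrite mxE (bigD1 i)//= big1 ?addr0// => l li.
by rewrite dA ?mul0r// eq_sym.
Qed.

Lemma fundamental_solution_zero_order (d : nat) (T : R)
    (A0 A1 A2 B : R -> R -> 'M[R]_d) (E : R -> R -> R -> R -> 'M[R]_d) :
  fundamental_solution T (add_zero_order (parabolic_op A0 A1 A2) B) E ->
  fundamental_solution T (parabolic_op (fun y t => A0 y t - B y t) A1 A2) E.
Proof.
move=> [cE dE gE]; split => // y0 s s0T y t st.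
have [? ? ? LE] := cE y0 s s0T y t st; split => //.
rewrite -[RHS]LE /add_zero_order /parabolic_op.
have -> : dy 0 (fun y t => E y t y0 s) y t = E y t y0 s.
  by apply/matrixP => i j; rewrite mxE.
rewrite mulmxBl; set a := A0 y t *m _; set b := B y t *m _.
set c := A1 y t *m _; set e := A2 y t *m _; clearbody a b c e.
by apply/matrixP => i j; rewrite !mxE; ring.
Qed.

Lemma powR_neg_le (x x0 p : R) : 0 < x0 -> x0 <= x -> 0 <= p ->
  x `^ (- p) <= x0 `^ (- p).
Proof.
move=> x00 xx p0; rewrite !powRN lef_pV2 ?posrE ?powR_gt0//; last first.
  exact: lt_le_trans xx.
by apply: ge0_ler_powR => //; rewrite nnegrE ltW// (lt_le_trans x00).
Qed.

Variables (d : nat) (T : R) (A0 A1 A2 : R -> R -> 'M[R]_d).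
Variable E : R -> R -> R -> R -> 'M[R]_d.
Hypothesis A1_diag : forall y t, 0 <= t <= T -> is_diag_mx (A1 y t).
Hypothesis A2_diag : forall y t, 0 <= t <= T -> is_diag_mx (A2 y t).
Hypothesis E_fund : fundamental_solution T (parabolic_op A0 A1 A2) E.

Variables (s Mphi : R) (phi : R -> R).
Hypothesis s0T : 0 <= s < T.
Hypothesis phi_cont : continuous phi.
Hypothesis phi_bnd : forall z, `|phi z| <= Mphi.

(** For fixed [j], the components in [i] form the solution with datum phi times the [j]-th basis
    vector. *)
Definition evolve (i j : 'I_d) (y t : R) :=
  \int[mu]_(z in setT) (E y t z s i j * phi z).

Lemma evolve_initial i j y :
  (fun p : R * R => evolve i j p.1 p.2) @ filter_prod (nbhs y) (at_right s)
    --> (i == j)%:R * phi y.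
Proof.
have [_ [_ H] _] := E_fund; apply: (H i j phi s y s0T phi_cont).
by exists Mphi.
Qed.

(** The factor (t - s)^(-1/2) of the Gaussian estimate cancels against the width sqrt(t - s), so the
    bound does not deteriorate as t tends to s. *)
Lemma evolve_bounded i j : exists N : R, forall y t, s < t < T ->
  mu.-integrable setT (EFin \o (fun z => E y t z s i j * phi z)) /\
  `|evolve i j y t| <= N.
Proof.
have [_ [cE _] [c [C [c0 C0 G]]]] := E_fund.
exists (C * Mphi * Num.sqrt (c^-1 * pi)) => y t st.
have /andP[s_t tT] := st; have u0 : 0 < t - s by rewrite subr_gt0.
have /andP[s0 _] := s0T.
pose a := c / (t - s); have a0 : 0 < a by rewrite divr_gt0.
have su0 : 0 < Num.sqrt (t - s) by rewrite sqrtr_gt0.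
have mE : measurable_fun setT (fun z => E y t z s i j * phi z).
  apply: measurable_funM; apply: continuous_measurable_fun => //.
  exact: cE.
have bE z : `|E y t z s i j * phi z| <=
    C / Num.sqrt (t - s) * Mphi * expR (- (a * (z - y) ^+ 2)).
  rewrite normrM mulrAC; apply: ler_pM => //.
  have [+ _] := G i j y t z s s0 st; move=> /(_ 0%N isT).
  rewrite mxE /= powRN mul1r powR12_sqrt ?(ltW u0)// => H.
  apply: (le_trans H); rewrite le_eqVlt; apply/orP; left; apply/eqP.
  rewrite real_normK ?num_real//; congr (_ * expR _).
  by rewrite /a; ring.
split; first exact: (integrable_le_gaussian a0 mE bE).
apply: le_trans (Rintegral_le_gaussian a0 mE bE) _.
have -> : Num.sqrt (a^-1 * pi) = Num.sqrt (t - s) * Num.sqrt (c^-1 * pi).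
  rewrite -sqrtrM ?(ltW u0)//; congr Num.sqrt.
  by rewrite /a invf_div -!mulrA; congr (_ * _).
rewrite le_eqVlt; apply/orP; left; apply/eqP.
by field; rewrite gt_eqF.
Qed.

(** The kernel equation for each pole is integrated against the datum. Diagonal [A1] and [A2] leave
    the components coupled through [A0] only, which goes into the source. *)
Lemma evolve_strip_solution i j :
  strip_solution s T (fun y t => A2 y t i i) (fun y t => A1 y t i i)
    (evolve i j) (fun y t => \sum_l A0 y t i l * evolve l j y t).
Proof.
have [clE [cE _] [c [C [c0 C0 G]]]] := E_fund.
have /andP[s0 sT] := s0T.
pose ky i y t z := derive1n 1 (fun v => E v t z s i j) y.
pose kyy i y t z := derive1n 2 (fun v => E v t z s i j) y.
pose kt i y t z := derive1 (fun v => E y v z s i j) t.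
have k_cont l y t : s < t < T -> continuous (fun z => E y t z s l j).
  by move=> st; exact: cE.
have k_dy l (y t z : R) : s < t < T ->
    is_derive y 1 (fun v => E v t z s l j) (ky l y t z).
  move=> st; have [d1 _ _ _] := clE z s s0T y t st.
  by apply: DeriveDef; [exact: d1|rewrite /ky derive1n1 derive1E].
have k_dyy l (y t z : R) : s < t < T ->
    is_derive y 1 (fun v => ky l v t z) (kyy l y t z).
  move=> st; have [_ d1 _ _] := clE z s s0T y t st.
  by apply: DeriveDef; [exact: d1|rewrite /kyy derive1nS derive1E].
have k_dt l (y t z : R) : s < t < T ->
    is_derive t 1 (fun v => E y v z s l j) (kt l y t z).
  move=> st; have [_ _ d1 _] := clE z s s0T y t st.
  by apply: DeriveDef; [exact: d1|rewrite /kt derive1E].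
have k_bnd l t0 : s < t0 -> exists K a : R, 0 < a /\
  forall y t z, t0 <= t < T ->
    [/\ `|E y t z s l j| <= K * expR (- (a * (z - y) ^+ 2)),
        `|ky l y t z| <= K * expR (- (a * (z - y) ^+ 2)),
        `|kyy l y t z| <= K * expR (- (a * (z - y) ^+ 2))
      & `|kt l y t z| <= K * expR (- (a * (z - y) ^+ 2))].
  move=> st0; have u0 : 0 < t0 - s by rewrite subr_gt0.
  pose P (k : nat) := (t0 - s) `^ (- (k.+1%:R / 2)).
  have P0 k : 0 <= P k by exact: powR_ge0.
  (* For t >= t0 the powers of t - s are at most those of t0 - s, and the Gaussian rate is smallest
     at t = T. *)
  exists (C * (P 0%N + P 1%N + P 2%N)), (c / (T - s)).
  split; first by rewrite divr_gt0// subr_gt0.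
  move=> y t z /andP[t0t tT]; have s_t : s < t by exact: lt_le_trans t0t.
  have st : s < t < T by rewrite s_t.
  have ts0 : 0 < t - s by rewrite subr_gt0.
  have expb : expR (- c * `|y - z| ^+ 2 / (t - s)) <=
      expR (- (c / (T - s) * (z - y) ^+ 2)).
    have iTt : (T - s)^-1 <= (t - s)^-1.
      by rewrite lef_pV2 ?posrE ?subr_gt0// lerD2r ltW.
    have cq : 0 <= c * (y - z) ^+ 2 by rewrite mulr_ge0 ?sqr_ge0// ltW.
    rewrite ler_expR real_normK ?num_real//.
    by have := ler_wpM2l cq iTt; lra.
  have bnd k (x : R) : (k <= 2)%N ->
      `|x| <= C * (t - s) `^ (- (k.+1%:R / 2)) *
        expR (- c * `|y - z| ^+ 2 / (t - s)) ->
      `|x| <= C * (P 0%N + P 1%N + P 2%N) * expR (- (c / (T - s) * (z - y) ^+ 2)).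
    move=> k2 H; apply: (le_trans H).
    apply: ler_pM => //; rewrite ?expR_ge0 ?mulr_ge0 ?powR_ge0 ?(ltW C0)//.
    rewrite ler_wpM2l ?(ltW C0)//.
    apply: (@le_trans _ _ (P k)).
      by apply: powR_neg_le; rewrite ?lerD2r ?divr_ge0.
    have := P0 0%N; have := P0 1%N; have := P0 2%N.
    by case: k k2 {H} => [|[|[|]]]// _ *; lra.
  have [+ Ht] := G l j y t z s s0 st; move=> Hk.
  have H0 := Hk 0%N isT; have H1 := Hk 1%N isT; have H2 := Hk 2%N isT.
  rewrite mxE in H0; rewrite mxE in H1; rewrite mxE in H2; rewrite mxE in Ht.
  (* The time derivative has the exponent 3/2 of the second space derivative. *)
  split; [exact: (bnd 0%N)|exact: (bnd 1%N)|exact: (bnd 2%N)|exact: (bnd 2%N)].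
have kint l := kernel_integrable (k_cont l) (k_dy l) (k_dyy l) (k_dt l) (k_bnd l)
  phi_cont phi_bnd.
have kder l := kernel_derivatives (k_cont l) (k_dy l) (k_dyy l) (k_dt l) (k_bnd l)
  phi_cont phi_bnd.
split.
- by have [N H] := evolve_bounded i j; exists N => y t st; have [] := H y t st.
- move=> y t st.
  exact: (kernel_continuous (k_cont i) (k_dy i) (k_dyy i) (k_dt i) (k_bnd i)
    phi_cont phi_bnd st).
pose P (h : R -> R -> R -> R) y t := \int[mu]_(z in setT) (h y t z * phi z).
exists (P (ky i)), (P (kyy i)), (P (kt i)) => y t st.
have [d1 d2 d3] := kder i y t st.
split; [exact: d1|exact: d2|exact: d3|].
have t0T : 0 <= t <= T.
  by case/andP: st => st tT; rewrite (ltW tT) (le_trans s0 (ltW st)).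
have [_ i1 i2 i3] := kint i y t st.
have i0 l : mu.-integrable setT (EFin \o (fun z => E y t z s l j * phi z)).
  by have [] := kint l y t st.
have pde z : kt i y t z * phi z = A2 y t i i * (kyy i y t z * phi z) +
    (A1 y t i i * (ky i y t z * phi z) +
     \sum_l A0 y t i l * (E y t z s l j * phi z)).
  have [_ _ _ LE] := clE z s s0T y t st.
  have := congr1 (fun m : 'M[R]_d => m i j) LE.
  rewrite /parabolic_op; set a := A0 y t *m _; set b := A1 y t *m _.
  set e := A2 y t *m _.
  have Ha : a i j = \sum_l A0 y t i l * E y t z s l j.
    by rewrite mxE; apply: eq_bigr => l _; rewrite mxE.
  have Hb : b i j = A1 y t i i * ky i y t z.
    by rewrite /b diag_mulmx_entry ?mxE//; exact: A1_diag.
  have He : e i j = A2 y t i i * kyy i y t z.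
    by rewrite /e diag_mulmx_entry ?mxE//; exact: A2_diag.
  clearbody a b e; rewrite !mxE Ha Hb He => H.
  have -> : kt i y t z = A2 y t i i * kyy i y t z + A1 y t i i * ky i y t z +
      \sum_l A0 y t i l * E y t z s l j.
    by move/eqP: H; rewrite subr_eq0 /kt => /eqP ->; ring.
  under [X in _ = _ + (_ + X)]eq_bigr do rewrite mulrA.
  by rewrite -mulr_suml; ring.
have [is_ ES] := @Rintegral_sum R d (fun l z => A0 y t i l * (E y t z s l j * phi z))
  (fun l => integrableZl measurableT (A0 y t i l) (i0 l)).
have iA1 := integrableZl measurableT (A1 y t i i) i1.
have iA2 := integrableZl measurableT (A2 y t i i) i2.
rewrite /P; under eq_Rintegral do rewrite pde.
rewrite RintegralD//; last exact: (integrableD measurableT iA1 is_).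
rewrite RintegralD// ES !RintegralZl// -addrA; congr (_ + (_ + _)).
by apply: eq_bigr => l _; rewrite RintegralZl.
Qed.

End fundamental_solution_theory.

(** * Gaussian data: mass, convolution and concentration at a point *)

Section heat_integrals.
Context {R : realType}.
Notation mu := (@lebesgue_measure R).
Variables (eps x : R).
Hypothesis eps0 : 0 < eps.

Lemma heat_cont (q t : R) : q < t -> continuous (heat eps x q ^~ t).
Proof.
move=> qt z; apply: differentiable_continuous; apply/derivable1_diffP.
by have [[]] := @heat_derivatives R eps x q z t qt.
Qed.

Lemma heat_gaussian (q t z : R) : q < t ->
  heat eps x q z t =
    (Num.sqrt (t - q))^-1 * expR (- (eps / (t - q) * (z - x) ^+ 2)).
Proof.
by move=> qt; rewrite heatE// mulrC; congr (_ * expR _); ring.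
Qed.

Lemma integrable_heat (q t : R) : q < t ->
  mu.-integrable setT (EFin \o (heat eps x q ^~ t)).
Proof.
move=> qt; have u0 : 0 < t - q by rewrite subr_gt0.
apply: (@integrable_le_gaussian R (eps / (t - q)) x (Num.sqrt (t - q))^-1).
- exact: divr_gt0.
- by apply: continuous_measurable_fun; exact: heat_cont.
- by move=> z; rewrite ger0_norm ?heat_gaussian// -heat_gaussian// ltW// heat_gt0.
Qed.

Lemma Rintegral_heat (q t : R) : q < t ->
  \int[mu]_(z in setT) heat eps x q z t = Num.sqrt (eps^-1 * pi).
Proof.
move=> qt; have u0 : 0 < t - q by rewrite subr_gt0.
have a0 : 0 < eps / (t - q) by exact: divr_gt0.
under eq_Rintegral do rewrite heat_gaussian//.
rewrite RintegralZl//; last exact: integrable_gaussian.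
rewrite Rintegral_gaussian// invf_div -mulrA sqrtrM ?(ltW u0)//.
by rewrite mulKf// gt_eqF// sqrtr_gt0.
Qed.

(** Completing the square, with [m] the new centre and [a] the combined rate. Both Gaussians have
    the same [eps], so their time lengths add; the missing normalisation leaves the mass sqrt(pi /
    eps), the source of the constant [c]. *)
Lemma heat_convolution (q sg t y : R) : q < sg -> sg < t ->
  mu.-integrable setT (EFin \o (fun z => (Num.sqrt (t - sg))^-1 *
    expR (- eps * (y - z) ^+ 2 / (t - sg)) * heat eps x q z sg)) /\
  \int[mu]_(z in setT) ((Num.sqrt (t - sg))^-1 *
    expR (- eps * (y - z) ^+ 2 / (t - sg)) * heat eps x q z sg) =
  Num.sqrt (eps^-1 * pi) * heat eps x q y t.
Proof.
move=> qsg sgt; have qt : q < t by exact: lt_trans sgt.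
have E1 : t - q = (t - sg) + (sg - q) by ring.
have u0 : 0 < t - sg by rewrite subr_gt0.
have v0 : 0 < sg - q by rewrite subr_gt0.
set u := t - sg in E1 u0 *; set v := sg - q in E1 v0 *.
have uv0 : 0 < u + v by exact: addr_gt0.
pose m := (y * v + x * u) / (u + v).
pose a := eps * (u + v) / (u * v).
have a0 : 0 < a by rewrite divr_gt0// mulr_gt0.
pose k := (Num.sqrt u)^-1 * (Num.sqrt v)^-1 *
  expR (- eps * (y - x) ^+ 2 / (u + v)).
have E z : (Num.sqrt u)^-1 * expR (- eps * (y - z) ^+ 2 / u) * heat eps x q z sg =
    k * expR (- (a * (z - m) ^+ 2)).
  rewrite heatE// -/v /k -[RHS]mulrA -expRD [_ * (_ / _)]mulrA.
  rewrite -(mulrA (Num.sqrt u)^-1) -expRD mulrAC; congr (_ * expR _).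
  rewrite /a /m; field.
  by rewrite !gt_eqF.
have ig := integrable_gaussian m a0.
have -> : (fun z => (Num.sqrt u)^-1 * expR (- eps * (y - z) ^+ 2 / u) *
    heat eps x q z sg) = (fun z => k * expR (- (a * (z - m) ^+ 2))).
  by apply/funext.
split.
  by have := integrableZl measurableT k ig.
rewrite RintegralZl// Rintegral_gaussian// heatE// E1.
have -> : a^-1 * pi = u * v / (u + v) * (eps^-1 * pi).
  by rewrite /a; field; rewrite !gt_eqF.
rewrite sqrtrM ?divr_ge0 ?mulr_ge0 ?ltW// sqrtrM ?mulr_ge0 ?ltW//.
rewrite sqrtrM ?(ltW u0)// sqrtrV ?(ltW uv0)//.
have su : Num.sqrt u != 0 by rewrite gt_eqF// sqrtr_gt0.
have sv : Num.sqrt v != 0 by rewrite gt_eqF// sqrtr_gt0.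
have suv : Num.sqrt (u + v) != 0 by rewrite gt_eqF// sqrtr_gt0.
by rewrite /k; field; rewrite su sv suv.
Qed.

(* [u exp(-u) <= 2 exp(-u / 2)] turns the second moment into a Gaussian
   integral. *)
Lemma Rintegral_heat_le (g : R -> R) (s r e K : R) : 0 < r -> 0 <= K ->
  mu.-integrable setT (EFin \o (fun z => g z * heat eps x (s - r) z s)) ->
  (forall z, g z <= g x + e + K * (z - x) ^+ 2) ->
  \int[mu]_(z in setT) (g z * heat eps x (s - r) z s) <=
    (g x + e) * Num.sqrt (eps^-1 * pi)
      + K * (2 / eps) * Num.sqrt (2 / eps * pi) * r.
Proof.
move=> r0 K0 ig gK; have qs : s - r < s by lra.
have sr : s - (s - r) = r by ring.
pose a := eps / (2 * r).
have a0 : 0 < a by rewrite divr_gt0// mulr_gt0.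
have sr0 : 0 < Num.sqrt r by rewrite sqrtr_gt0.
pose k := K * (2 * r / eps) * (Num.sqrt r)^-1.
have pw z : g z * heat eps x (s - r) z s <=
    (g x + e) * heat eps x (s - r) z s + k * expR (- (a * (z - x) ^+ 2)).
  have h0 := ltW (heat_gt0 eps x (s - r) z s).
  have := ler_wpM2r h0 (gK z); rewrite mulrDl => H; apply: (le_trans H).
  rewrite lerD2l heat_gaussian// sr /k.
  pose w := a * (z - x) ^+ 2.
  have w0 : 0 <= w by rewrite mulr_ge0 ?sqr_ge0// ltW.
  have -> : eps / r * (z - x) ^+ 2 = w + w.
    by rewrite /w /a; field; rewrite gt_eqF.
  have -> : K * (z - x) ^+ 2 = K * (2 * r / eps) * w.
    by rewrite /w /a; field; rewrite !gt_eqF.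
  rewrite -/w opprD expRD.
  have A : w * expR (- w) <= 1.
    rewrite expRN ler_pdivrMr ?expR_gt0// mul1r.
    by apply: le_trans (expR_ge1Dx w); lra.
  have B : 0 <= K * (2 * r / eps) * (Num.sqrt r)^-1 * expR (- w).
    rewrite mulr_ge0 ?expR_ge0// mulr_ge0 ?invr_ge0 ?(ltW sr0)//.
    by rewrite mulr_ge0// divr_ge0 ?(ltW eps0)// mulr_ge0// ltW.
  by have := ler_wpM2l B A; lra.
have ih := integrableZl measurableT (g x + e) (integrable_heat qs).
have iG := integrableZl measurableT k (integrable_gaussian x a0).
apply: le_trans (le_Rintegral measurableT ig _ (fun z _ => pw z)) _.
  by have := integrableD measurableT ih iG.
rewrite (RintegralD measurableT ih iG) (RintegralZl _ measurableT (integrable_heat qs)).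
rewrite (RintegralZl _ measurableT (integrable_gaussian x a0)).
rewrite Rintegral_heat// lerD2l Rintegral_gaussian//.
have -> : a^-1 * pi = r * (2 / eps * pi) by rewrite /a; field; rewrite !gt_eqF.
rewrite sqrtrM ?(ltW r0)// le_eqVlt; apply/orP; left; apply/eqP.
by rewrite /k; field; rewrite !gt_eqF.
Qed.

(** Continuity handles [z] near [x]; at distance at least [eta] the quadratic term alone exceeds the
    oscillation 2 N. Such a majorant integrates explicitly against a Gaussian. *)
Lemma quadratic_upper_bound (g : R -> R) (N e : R) : 0 < e ->
  {for x, continuous g} -> (forall z, `|g z| <= N) ->
  exists2 K, 0 <= K & forall z, g z <= g x + e + K * (z - x) ^+ 2.
Proof.
move=> e0 /cvgrPdist_lt/(_ _ e0)[eta /= eta0 H] gN.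
have N0 : 0 <= N by exact: le_trans (gN 0).
have eta2 : 0 < eta ^+ 2 by rewrite exprn_gt0.
exists (2 * N / eta ^+ 2) => [|z]; first by rewrite divr_ge0 ?mulr_ge0// ltW.
have K0 : 0 <= 2 * N / eta ^+ 2 by rewrite divr_ge0 ?mulr_ge0// ltW.
have sq : 0 <= (z - x) ^+ 2 by exact: sqr_ge0.
have [zx|zx] := ltP `|x - z| eta.
  have := H z zx; rewrite ltr_norml => /andP[K1 K2].
  by have := mulr_ge0 K0 sq; lra.
have : 2 * N <= 2 * N / eta ^+ 2 * (z - x) ^+ 2.
  rewrite mulrAC ler_pdivlMr// ler_wpM2l ?mulr_ge0//.
  rewrite -(@real_normK _ (z - x)) ?num_real// distrC.
  by apply: lerXn2r; rewrite ?nnegrE// ltW.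
have := gN z; have := gN x; rewrite !ler_norml => /andP[? ?] /andP[? ?].
lra.
Qed.

End heat_integrals.

(** * Entrywise infimum, nonnegative matrices and the exponential series *)

Section coefficient_facts.
Context {R : realType}.
Variables (d : nat) (T : R).

Lemma inf_mx_le (B : R -> R -> 'M[R]_d) i j y t :
  (forall y t i j, 0 <= t <= T -> 0 <= B y t i j) -> 0 <= t <= T ->
  inf_mx T B i j <= B y t i j.
Proof.
move=> B0 tT; rewrite mxE; apply: ge_inf; last by exists y, t.
by exists 0 => _ [y' [t' [tT' ->]]]; exact: B0.
Qed.

Lemma inf_mx_ge0 (B : R -> R -> 'M[R]_d) i j : 0 <= T ->
  (forall y t i j, 0 <= t <= T -> 0 <= B y t i j) -> 0 <= inf_mx T B i j.
Proof.
move=> T0 B0; rewrite mxE; apply: lb_le_inf.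
  by exists (B 0 0 i j), 0, 0; rewrite lexx.
by move=> _ [y' [t' [tT' ->]]]; exact: B0.
Qed.

Lemma expr_mx_ge0 (A : 'M[R]_d) k i j :
  (forall i j, 0 <= A i j) -> 0 <= (A ^+ k) i j.
Proof.
move=> A0; elim: k i j => [|k IH] i j.
  by rewrite expr0 mxE; case: (_ == _).
by rewrite exprS mxE; apply: sumr_ge0 => l _; rewrite mulr_ge0.
Qed.

(** The bound on partial sums also proves the convergence that [limn] requires, since the terms are
    nonnegative. *)
Lemma expmx_le (A : 'M[R]_d) i j (b : R) : (forall i j, 0 <= A i j) ->
  (forall n, \sum_(k < n) (A ^+ k) i j / k`!%:R <= b) -> expmx A i j <= b.
Proof.
move=> A0 Ab; rewrite mxE.
set u := fun k : nat => (A ^+ k) i j / k`!%:R.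
have u0 k : 0 <= u k by rewrite divr_ge0// expr_mx_ge0.
have ub n : series u n <= b by rewrite /series/= big_mkord.
have nd : nondecreasing_seq (series u).
  by apply/nondecreasing_seqP => n; rewrite !seriesEnat/= big_nat_recr//= lerDl.
have cu : cvgn (series u).
  apply: nondecreasing_is_cvgn => //.
  by exists b => _ [n _ <-]; exact: ub.
by apply: limr_le => //; apply: nearW.
Qed.

Lemma positive_definite_diag (A : R -> R -> 'M[R]_d) i y t :
  unif_positive_definite T A -> 0 <= t <= T -> 0 <= A y t i i.
Proof.
move=> [lam lam0 H] tT; have := H y t (delta_mx i 0) tT.
rewrite trmx_delta -rowE -colE !mxE => K; apply: le_trans K.
by rewrite mulr_ge0 ?(ltW lam0)// sumr_ge0// => k _; exact: sqr_ge0.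
Qed.

End coefficient_facts.

Lemma expr_scalemx (R : comPzRingType) (d : nat) (a : R) (A : 'M[R]_d) p :
  (a *: A) ^+ p = a ^+ p *: A ^+ p.
Proof.
elim: p => [|p IH]; first by rewrite !expr0 scale1r.
rewrite !exprS IH -[LHS]/(a *: A *m (a ^+ p *: A ^+ p)).
by rewrite -scalemxAl -scalemxAr scalerA.
Qed.

(** * The lower bound *)

Section lower_bound.
Context {R : realType}.
Notation mu := (@lebesgue_measure R).
Variables (d : nat) (T : R) (A0 A1 A2 B : R -> R -> 'M[R]_d).
Variables (E : R -> R -> R -> R -> 'M[R]_d) (e : 'I_d -> R -> R -> R -> R -> R).
Variables (delta0 eps0 : R).
Hypothesis A0_bdd : coeff_bounded T A0.
Hypothesis A1_bdd : coeff_bounded T A1.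
Hypothesis A2_bdd : coeff_bounded T A2.
Hypothesis B_bdd : coeff_bounded T B.
Hypothesis A2_pos : unif_positive_definite T A2.
Hypothesis A1_diag : forall y tau : R, 0 <= tau <= T -> is_diag_mx (A1 y tau).
Hypothesis A2_diag : forall y tau : R, 0 <= tau <= T -> is_diag_mx (A2 y tau).
Hypothesis A0_offdiag_ge0 : forall (y tau : R) (i j : 'I_d),
  0 <= tau <= T -> i != j -> 0 <= A0 y tau i j.
Hypothesis A0B_diag : forall y tau : R,
  0 <= tau <= T -> is_diag_mx (A0 y tau - B y tau).
Hypothesis B_ge0 : forall (y tau : R) (i j : 'I_d),
  0 <= tau <= T -> 0 <= B y tau i j.
Hypothesis E_fund : fundamental_solution T (parabolic_op A0 A1 A2) E.
Hypothesis Ediag_fund :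
  fundamental_solution T (add_zero_order (parabolic_op A0 A1 A2) B)
    (fun y tau y0 s => diag_mx (\row_i e i y tau y0 s)).
Hypothesis delta0_gt0 : 0 < delta0.
Hypothesis eps0_gt0 : 0 < eps0.
Hypothesis aronson : forall (i : 'I_d) (y y0 s tau : R), 0 <= s -> s < tau < T ->
  e i y tau y0 s >= delta0 * (Num.sqrt (tau - s))^-1
    * expR (- eps0 * (y - y0) ^+ 2 / (tau - s)).

Let D y t := A0 y t - B y t.
Let Ed y t y0 s : 'M[R]_d := diag_mx (\row_i e i y t y0 s).
Let Ed_fund : fundamental_solution T (parabolic_op D A1 A2) Ed.
Proof. exact: fundamental_solution_zero_order. Qed.

Let kappa := Num.sqrt (eps0^-1 * pi).
Let c := delta0 * kappa.
Let Bs := inf_mx T B.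

Let kappa0 : 0 < kappa.
Proof. by rewrite sqrtr_gt0 mulr_gt0 ?invr_gt0 ?pi_gt0. Qed.

Let c0 : 0 < c. Proof. exact: mulr_gt0. Qed.

Lemma coefficients_bounded : exists2 M : R, 0 <= M &
  forall y t, 0 <= t <= T -> forall i j,
    [/\ 0 <= A2 y t i i <= M, `|A1 y t i i| <= M, `|A0 y t i j| <= M
      & `|D y t i i| <= M].
Proof.
have [[M0 H0] [M1 H1]] := (A0_bdd, A1_bdd).
have [[M2 H2] [M3 H3]] := (A2_bdd, B_bdd).
exists (`|M0| + `|M1| + `|M2| + `|M3|) => [|y t tT i j]; first by rewrite !addr_ge0.
have n0 := normr_ge0 M0; have n1 := normr_ge0 M1.
have n2 := normr_ge0 M2; have n3 := normr_ge0 M3.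
have l0 := ler_norm M0; have l1 := ler_norm M1.
have l2 := ler_norm M2; have l3 := ler_norm M3.
have h0 := H0 i j y t tT; have h1 := H1 i i y t tT; have h2 := H2 i i y t tT.
have h3 := H3 i i y t tT; have h4 := H0 i i y t tT.
split; [|lra|lra|].
- have p2 := positive_definite_diag i y A2_pos tT.
  by rewrite p2 /=; have := ler_norm (A2 y t i i); lra.
- have -> : D y t i i = A0 y t i i - B y t i i by rewrite /D !mxE.
  by have := ler_normB (A0 y t i i) (B y t i i); lra.
Qed.

(** * Lower bound for a datum whose pole lies at time [s - r] *)

Section regularized_pole.
Variables (s x r : R) (j : 'I_d).
Hypothesis s0T : 0 <= s < T.
Hypothesis r0 : 0 < r.

Let q := s - r.
Let gam := heat eps0 x q.
Let U k := evolve E s (gam ^~ s) k j.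
(** Every restart takes its datum from the same function [gam], whatever the time [sg]; this is what
    lets one comparison function serve all nodes of the Riemann sum. *)
Let psi i sg := evolve Ed sg (gam ^~ sg) i i.

Let qs : q < s. Proof. by rewrite /q ltrBlDr ltrDl. Qed.

Let strip0T t : s < t < T -> 0 <= t <= T.
Proof. by case/andP: s0T => s0 _ /andP[st tT]; rewrite (ltW tT) (le_trans s0 (ltW st)). Qed.

Let sg0T sg : s <= sg < T -> 0 <= sg < T.
Proof. by case/andP: s0T => s0 _ /andP[st ->]; rewrite (le_trans s0). Qed.

Let gam_bnd : exists N, forall y t, s <= t -> `|gam y t| <= N.
Proof.
have [N HN] := @heat_bounded R eps0 x q eps0_gt0 (r / 2) (divr_gt0 r0 (ltr0n R 2)).
exists N => y t st; have qrt : q + r / 2 < t.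
  by have r1 := r0; rewrite /q; lra.
by have [] := HN y t qrt.
Qed.

Let gam_cont t : s <= t -> continuous (gam ^~ t).
Proof. by move=> st; apply: heat_cont; exact: lt_le_trans st. Qed.

Let gam_ge0 y t : 0 <= gam y t.
Proof. exact/ltW/heat_gt0. Qed.

Let gam_initial sg y : s <= sg ->
  (fun p : R * R => gam p.1 p.2) @ filter_prod (nbhs y) (at_right sg) --> gam y sg.
Proof.
move=> ssg; apply: cvg_initial; apply: heat_continuous.
exact: lt_le_trans ssg.
Qed.

Let psi_initial i sg y : s <= sg < T ->
  (fun p : R * R => psi i sg p.1 p.2) @ filter_prod (nbhs y) (at_right sg)
    --> gam y sg.
Proof.
move=> sgT; have [N HN] := gam_bnd; have /andP[ssg _] := sgT.
have H := evolve_initial Ed_fund (sg0T sgT) (gam_cont ssg) (fun z => HN z sg ssg).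
by have := H i i y; rewrite eqxx mul1r.
Qed.

Let U_initial k y :
  (fun p : R * R => U k p.1 p.2) @ filter_prod (nbhs y) (at_right s)
    --> (k == j)%:R * gam y s.
Proof.
have [N HN] := gam_bnd.
exact: (evolve_initial E_fund s0T (gam_cont (lexx s)) (fun z => HN z s (lexx s))).
Qed.

Let U_sol k : strip_solution s T (fun y t => A2 y t k k) (fun y t => A1 y t k k)
  (U k) (fun y t => \sum_l A0 y t k l * U l y t).
Proof.
have [N HN] := gam_bnd.
exact: (evolve_strip_solution A1_diag A2_diag E_fund s0T
  (gam_cont (lexx s)) (fun z => HN z s (lexx s))).
Qed.

Let psi_sol i sg : s <= sg < T ->
  strip_solution sg T (fun y t => A2 y t i i) (fun y t => A1 y t i i)
    (psi i sg) (fun y t => D y t i i * psi i sg y t).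
Proof.
move=> sgT; have [N HN] := gam_bnd; have /andP[ssg _] := sgT.
have H := evolve_strip_solution A1_diag A2_diag Ed_fund
  (sg0T sgT) (gam_cont ssg) (fun z => HN z sg ssg).
apply: strip_solution_eq (H i i) => // y t st.
have tT : 0 <= t <= T.
  by case/andP: st => st tT; apply: strip0T; rewrite tT (le_lt_trans ssg).
rewrite (bigD1 i)//= big1 ?addr0// => l li.
have /is_diag_mxP dD := A0B_diag y tT.
by rewrite /D dD ?mul0r// eq_sym.
Qed.

Let psi_ge i sg y t : s <= sg < T -> sg < t < T -> c * gam y t <= psi i sg y t.
Proof.
move=> sgT st; have [N HN] := gam_bnd; have /andP[ssg _] := sgT.
have /andP[sg0 _] := sg0T sgT; have /andP[sgt tT] := st.
have H := evolve_bounded Ed_fund (sg0T sgT) (gam_cont ssg) (fun z => HN z sg ssg).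
have [_ /(_ y t st)[iE _]] := H i i.
have qsg : q < sg by exact: lt_le_trans ssg.
have [ih Eh] := heat_convolution x eps0_gt0 y qsg sgt.
rewrite /c -mulrA -/kappa -Eh -RintegralZl//.
apply: le_Rintegral => //; first by have := integrableZl measurableT delta0 ih.
move=> z _; rewrite mulrA ler_wpM2r//.
rewrite /Ed !mxE eqxx mulr1n mulrA; exact: aronson.
Qed.

Let U_ge0 k y t : s < t < T -> 0 <= U k y t.
Proof.
have [M M0 HM] := coefficients_bounded.
apply: (@cooperative_max_principle R s T M d (fun k y t => A2 y t k k)
  (fun k y t => A1 y t k k) U (fun k y t => \sum_l A0 y t k l * U l y t)
  (fun k l y t => A0 y t k l)) => //.
- by move=> i v u su; have [] := HM v u (strip0T su) i i.
- by move=> i v u su; have [] := HM v u (strip0T su) i i.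
- by move=> i l v u su; have [] := HM v u (strip0T su) i l.
- by move=> i l v u su; apply: A0_offdiag_ge0; exact: strip0T.
- move=> i; apply: (initially_ge0_cvg (@U_initial i)) => v.
  by rewrite mulr_ge0.
Qed.

Let partial_exp N i X : R :=
  \sum_(p < N) (c * X) ^+ p / p`!%:R * (Bs ^+ p) i j.

Let Bs_ge0 i l : 0 <= Bs i l.
Proof.
apply: inf_mx_ge0 => //; case/andP: s0T => s0 /ltW; exact: le_trans.
Qed.

(** The induction goes over all components at once, since the bound for row [i] uses those of all
    rows [l] through the coupling. Integrating X^p / p! raises the order of the series by one. *)
Lemma evolve_heat_ge N i y t : s < t < T ->
  c * gam y t * partial_exp N i (t - s) <= U i y t.
Proof.
have [M M0 HM] := coefficients_bounded.
elim: N i y t => [|N IH] i y t st.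
  by rewrite /partial_exp big_ord0 mulr0; exact: U_ge0.
pose a2 y t := A2 y t i i; pose a1 y t := A1 y t i i; pose a0 y t := D y t i i.
have a2_bnd v u : s < u < T -> 0 <= a2 v u <= M.
  by move=> su; have [] := HM v u (strip0T su) i i.
have a1_bnd v u : s < u < T -> `|a1 v u| <= M.
  by move=> su; have [] := HM v u (strip0T su) i i.
have a0_bnd v u : s < u < T -> `|a0 v u| <= M.
  by move=> su; have [] := HM v u (strip0T su) i i.
have a2_bnd' v u : s < u < T -> `|a2 v u| <= M.
  by move=> su; have /andP[p0 pM] := a2_bnd v u su; rewrite ger0_norm.
have [fg [sgam [Kf Hf]]] := heat_strip_solution x eps0_gt0 qs M0 a2_bnd' a1_bnd.
have [Ng HNg] := gam_bnd.
pose K1 := `|Kf| + M * `|Ng|.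
have K10 : 0 <= K1 by rewrite addr_ge0// mulr_ge0.
pose K := K1 * expR (M * (T - s)).
have K0 : 0 <= K by rewrite mulr_ge0 ?expR_ge0.
have fgK v u : s < u < T -> a0 v u * gam v u - K1 <= fg v u.
  move=> su; have := Hf v u su; rewrite ler_norml => /andP[f1 _].
  have := ler_norm Kf.
  have : a0 v u * gam v u <= M * `|Ng|.
    rewrite (le_trans (ler_norm _))// normrM; apply: ler_pM => //.
      exact: a0_bnd.
    have /andP[/ltW su' _] := su.
    by rewrite (le_trans (HNg v u su'))// ler_norm.
  rewrite /K1; lra.
have psi_bnd sg : s <= sg < T -> forall v u, sg < u < T ->
    0 <= psi i sg v u <= gam v u + K * (u - sg).
  move=> sgT v u su; have /andP[ssg _] := sgT.
  rewrite (le_trans _ (psi_ge i v sgT su)) ?(mulr_ge0 (ltW c0))//=.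
  apply: (@evolution_le R s T M a2 a1 a0 M0 a2_bnd a1_bnd a0_bnd sg K1 gam fg
    (psi i sg) ssg K10 sgam fgK (psi_sol i sgT)) => //.
  apply: (@initially_ge0_cvg R sg _ (fun z => gam z sg - gam z sg)) => z; last first.
    by rewrite subrr.
  by apply: cvgB; [exact: gam_initial|exact: psi_initial].
have ssT : s <= s < T by case/andP: s0T => _ ->; rewrite lexx.
pose del : R := (i == j)%:R.
have del0 : 0 <= del by [].
(* Removing the free evolution of the component's own datum leaves zero initial value. The removed
   part returns at the end as the identity term of the series. *)
have sW := strip_solution_scale_add (- del) (psi_sol i ssT) (U_sol i).
have iW : initially_ge0 s (fun v u => - del * psi i s v u + U i v u).
  apply: (@initially_ge0_cvg R s _ (fun z => - del * gam z s + del * gam z s)) => z.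
    apply: cvgD; last exact: U_initial.
    by apply: cvgM; [exact: cvg_cst|exact: psi_initial].
  by rewrite mulNr addNr.
(* Of the [p.+1] factors [c], [p] come from the partial sum and one from the prefactor of the
   induction hypothesis; the [c] in front of the new bound comes from the restarted solutions. *)
pose f p := c ^+ p.+1 / p`!%:R * (Bs ^+ p.+1) i j.
have f0 p : 0 <= f p.
  apply: mulr_ge0; last exact: expr_mx_ge0.
  by apply: divr_ge0 => //; apply: exprn_ge0; exact: ltW.
have fge v u : s < u < T ->
    a0 v u * (- del * psi i s v u + U i v u) +
      (\sum_(p < N) f p * (u - s) ^+ p) * gam v u <=
    - del * (D v u i i * psi i s v u) + \sum_l A0 v u i l * U l v u.
  move=> su; have uT := strip0T su.
  (* Splitting A0 = D + B with [D] diagonal: row [i] keeps its own zero-order term, and the coupling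
     by [B] becomes the source. *)
  have -> : \sum_l A0 v u i l * U l v u =
      D v u i i * U i v u + \sum_l B v u i l * U l v u.
    rewrite (bigD1 i)//= [in RHS](bigD1 i)//= addrA -mulrDl; congr (_ * _ + _).
      by rewrite /D !mxE subrK.
    apply: eq_bigr => l li; congr (_ * _).
    have /is_diag_mxP H := A0B_diag v uT.
    have := H i l; rewrite !mxE => /(_ _)/eqP; rewrite subr_eq0 => H'.
    by apply/eqP/H'; rewrite eq_sym.
  have -> : \sum_(p < N) f p * (u - s) ^+ p =
      \sum_l Bs i l * (c * partial_exp N l (u - s)).
    under [RHS]eq_bigr do rewrite /partial_exp 2!mulr_sumr.
    rewrite exchange_big/=; apply: eq_bigr => p _.
    rewrite /f [Bs ^+ p.+1]exprS mxE mulrAC mulr_sumr; apply: eq_bigr => l _.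
    by rewrite exprS (exprMn _ c); ring.
  have : (\sum_l Bs i l * (c * partial_exp N l (u - s))) * gam v u <=
      \sum_l B v u i l * U l v u.
    rewrite mulr_suml; apply: ler_sum => l _.
    apply: (@le_trans _ _ (Bs i l * U l v u)).
      rewrite -mulrA ler_wpM2l//; apply: le_trans (IH l v u su).
      by rewrite mulrAC.
    by rewrite ler_wpM2r ?U_ge0//; exact: inf_mx_le.
  rewrite /a0; lra.
have H := @duhamel_lower_bound R s T M a2 a1 a0 M0 a2_bnd a1_bnd a0_bnd K c _ _ gam
  (psi i) K0 sW iW (fun v u _ => gam_ge0 v u) (psi_sol i) psi_bnd (ltW c0)
  (fun sg sgT v u su => psi_ge i v sgT su) N f f0 fge y t st.
have P0 := ler_wpM2l del0 (psi_ge i y ssT st).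
have -> : partial_exp N.+1 i (t - s) =
    del + \sum_(p < N) f p * ((t - s) ^+ p.+1 / p.+1%:R).
  rewrite /partial_exp big_ord_recl; congr (_ + _).
    by rewrite !expr0 mxE invr1 !mul1r.
  apply: eq_bigr => p _; rewrite /f lift0 factS natrM (exprMn _ c) invfM; ring.
move: H; lra.
Qed.

End regularized_pole.

(** As r tends to 0, the smoothed solution is at most its kernel value at the pole times the mass of
    the datum, up to a vanishing error. An upper bound suffices, since the lower bound is already
    known for each [r]. *)
Lemma fundamental_solution_ge (s x y t : R) (i j : 'I_d) N : 0 <= s -> s < t < T ->
  delta0 * heat eps0 x s y t *
    (\sum_(p < N) (c * (t - s)) ^+ p / p`!%:R * (Bs ^+ p) i j) <= E y t x s i j.
Proof.
move=> s0 st; have /andP[s_t tT] := st.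
have s0T : 0 <= s < T by rewrite s0 (lt_trans s_t).
set P := \sum_(p < N) _.
have P0 : 0 <= P.
  apply: sumr_ge0 => p _; apply: mulr_ge0; last first.
    apply: expr_mx_ge0 => k l; apply: inf_mx_ge0 => //.
    by rewrite ltW// (le_lt_trans s0)// (lt_trans s_t).
  apply: divr_ge0 => //; apply: exprn_ge0; apply: mulr_ge0; first exact: ltW.
  by rewrite subr_ge0 ltW.
have [_ [cE _] [ce [CE [ce0 CE0 GE]]]] := E_fund.
pose g z := E y t z s i j.
have cg : {for x, continuous g} by exact: cE.
have [Ng HNg] : exists Ng, forall z, `|g z| <= Ng.
  exists (CE * (t - s) `^ (- (1 / 2))) => z.
  have [/(_ 0%N isT) + _] := GE i j y t z s s0 st; rewrite mxE /= => H.
  apply: (le_trans H); rewrite ler_piMr ?mulr_ge0 ?powR_ge0 ?(ltW CE0)//.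
  rewrite -expR0 ler_expR mulNr mulNr oppr_le0 mulr_ge0//.
    by rewrite mulr_ge0 ?sqr_ge0// ltW.
  by rewrite invr_ge0 subr_ge0 ltW.
have cP0 : 0 <= c * P by apply: mulr_ge0 => //; exact: ltW.
(* The mass [kappa] of the datum cancels against c = delta0 kappa. *)
suff : c * heat eps0 x s y t * P <= g x * kappa.
  rewrite {1}/c (mulrC delta0) -!mulrA (mulrC (g x)) ler_pM2l//.
apply/ler_addgt0Pr => eta eta0.
(* Three losses share [eta]: c P e1 from moving the pole of the Gaussian, kappa e1 from the
   oscillation of [g] near [x], and e1 from the second moment of the datum. *)
pose e1 := eta / (c * P + kappa + 1).
have den0 : 0 < c * P + kappa + 1 by have k0 := kappa0; lra.
have e10 : 0 < e1 by exact: divr_gt0.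
have [K K0 HK] := quadratic_upper_bound e10 cg HNg.
pose K' := K * (2 / eps0) * Num.sqrt (2 / eps0 * pi).
have K'0 : 0 <= K'.
  apply: mulr_ge0 => //; apply: mulr_ge0 => //.
  by rewrite divr_ge0// ltW.
have [_ _ dh] := heat_derivatives eps0 x y s_t.
have ch : {for t, continuous (heat eps0 x s y)}.
  by apply: differentiable_continuous; apply/derivable1_diffP; case: dh.
have /cvgrPdist_lt/(_ _ e10)[rho /= rho0 Hrho] := ch.
have K'1 : 0 < K' + 1 by lra.
pose r := Num.min (rho / 2) (e1 / (K' + 1)).
have r0 : 0 < r by rewrite lt_min !divr_gt0.
have rrho : r < rho.
  have : r <= rho / 2 by rewrite ge_min lexx.
  lra.
have rK : K' * r <= e1.
  have : r <= e1 / (K' + 1) by rewrite ge_min lexx orbT.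
  rewrite ler_pdivlMr// => H; have := ltW r0; lra.
(* An earlier pole is a later time, so continuity in time at [t] suffices. *)
have hr : heat eps0 x (s - r) y t = heat eps0 x s y (t + r).
  by rewrite /heat; have -> : t - (s - r) = t + r - s by ring.
have := Hrho (t + r); rewrite /ball_/= opprD addNKr normrN gtr0_norm//.
move=> /(_ rrho); rewrite -hr ltr_norml => /andP[_ hh].
have H1 : c * heat eps0 x (s - r) y t * P <=
    evolve E s (heat eps0 x (s - r) ^~ s) i j y t by exact: evolve_heat_ge.
have [Nh Hh] : exists Nh, forall z, `|heat eps0 x (s - r) z s| <= Nh.
  have [Nh Hh] := heat_bounded x (s - r) eps0_gt0 (divr_gt0 r0 (ltr0n R 2)).
  exists Nh => z; have sr : s - r + r / 2 < s by lra.
  by have [] := Hh z s sr.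
have qs : s - r < s by lra.
have ev := evolve_bounded E_fund s0T (@heat_cont R eps0 x _ _ qs) Hh.
have [_ /(_ y t st)[ig _]] := ev i j.
have H2 := Rintegral_heat_le eps0_gt0 r0 K0 ig HK.
rewrite -/kappa -/K' in H2.
have H3 := le_trans H1 H2.
have H4 : 0 <= c * P * (heat eps0 x (s - r) y t + e1 - heat eps0 x s y t).
  by apply: mulr_ge0 => //; lra.
have H5 : e1 * (c * P + kappa + 1) = eta by rewrite /e1 divfK// gt_eqF.
have : c * heat eps0 x s y t * P <=
  c * heat eps0 x (s - r) y t * P + c * P * e1 by lra.
move: H3 rK H5; rewrite /g; lra.
Qed.

Lemma exponential_lower_bound : Defs.lower_bound T eps0 Bs E c delta0.
Proof.
move=> i j y x s t s0 st; have /andP[s_t tT] := st.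
have -> : expR (- eps0 * (y - x) ^+ 2 / (t - s)) / Num.sqrt (t - s) =
  heat eps0 x s y t by rewrite heatE.
have dh0 : 0 < delta0 * heat eps0 x s y t by rewrite mulr_gt0// heat_gt0.
rewrite mulrAC mulrC -ler_pdivlMr//.
have X0 : 0 <= c * (t - s).
  by apply: mulr_ge0; [exact: ltW|rewrite subr_ge0 ltW].
have T0 : 0 <= T by rewrite ltW// (le_lt_trans s0)// (lt_trans s_t).
apply: expmx_le => [k l|n].
  rewrite mxE mulr_ge0//; apply: inf_mx_ge0 => //.
rewrite ler_pdivlMr// mulrC.
apply: le_trans (fundamental_solution_ge x y i j n s0 st).
rewrite ler_pM2l// le_eqVlt; apply/orP; left; apply/eqP.
apply: eq_bigr => p _.
by rewrite expr_scalemx mxE mulrAC.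
Qed.

End lower_bound.
Theorem theoremB2 (R : realType) (d : nat) (T alpha : R)
    (A0 A1 A2 B : R -> R -> 'M[R]_d)
    (E : R -> R -> R -> R -> 'M[R]_d)
    (e : 'I_d -> R -> R -> R -> R -> R)
    (delta0 eps0 : R)
    (T_gt0 : 0 < T) (alpha_gt0 : 0 < alpha)
    (A0_reg : coeff_regular T alpha A0)
    (A1_reg : coeff_regular T alpha A1)
    (A2_reg : coeff_regular T alpha A2)
    (B_reg : coeff_regular T alpha B)
    (A2_pos : unif_positive_definite T A2)
    (A1_diag : forall y tau : R, 0 <= tau <= T -> is_diag_mx (A1 y tau))
    (A2_diag : forall y tau : R, 0 <= tau <= T -> is_diag_mx (A2 y tau))
    (A0_offdiag_ge0 : forall (y tau : R) (i j : 'I_d),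
       0 <= tau <= T -> i != j -> 0 <= A0 y tau i j)
    (A0B_diag : forall y tau : R,
       0 <= tau <= T -> is_diag_mx (A0 y tau - B y tau))
    (B_ge0 : forall (y tau : R) (i j : 'I_d),
       0 <= tau <= T -> 0 <= B y tau i j)
    (E_fund : fundamental_solution T (parabolic_op A0 A1 A2) E)
    (Ediag_fund :
       fundamental_solution T (add_zero_order (parabolic_op A0 A1 A2) B)
         (fun y tau y0 s => diag_mx (\row_i e i y tau y0 s)))
    (delta0_gt0 : 0 < delta0) (eps0_gt0 : 0 < eps0)
    (aronson : forall (i : 'I_d) (y y0 s tau : R), 0 <= s -> s < tau < T ->
       e i y tau y0 s >=
         delta0 * (Num.sqrt (tau - s))^-1
           * expR (- eps0 * (y - y0) ^+ 2 / (tau - s))) :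
  (exists c C : R,
     [/\ 0 < c, 0 < C & lower_bound T eps0 (inf_mx T B) E c C]) /\
  lower_bound T eps0 (inf_mx T B) E
    (delta0 * Num.sqrt (eps0^-1 * pi)) delta0.

Proof.
case: A0_reg A1_reg A2_reg B_reg => A0_bdd _ _ [A1_bdd _ _] [A2_bdd _ _] [B_bdd _ _].
have LB : lower_bound T eps0 (inf_mx T B) E (delta0 * Num.sqrt (eps0^-1 * pi)) delta0.
  exact: exponential_lower_bound A2_pos A1_diag A2_diag A0_offdiag_ge0 A0B_diag
    B_ge0 E_fund Ediag_fund delta0_gt0 eps0_gt0 aronson.
split => //; exists (delta0 * Num.sqrt (eps0^-1 * pi)), delta0; split => //.
by rewrite mulr_gt0// sqrtr_gt0 mulr_gt0 ?invr_gt0 ?pi_gt0.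
Qed.
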